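(* Let $A>1$. For each $n\ge 1$ let $\lambda_n$ be an $A$-balanced Young diagram with $n$ boxes, let $\rho_n$ be the corresponding irreducible representation of $S_n$, and assume that the diagrams $\lambda_n$ have a limit shape as $n\to\infty$. Let $(k_n)_{n\ge1}$ be a sequence of integers with $0\le k_n\le n$. Let $(\mathcal{A}_n,\varphi_n)$ be the non-commutative probability space of operators on $\mathbb{C}[S_{n+1}]$ described in the context, let $X_n\in\mathcal{A}_n$ be the operator of left multiplication by the Jucys-Murphy element $(1,n+1)+(2,n+1)+\cdots+(n,n+1)$, and let $P_n\in\mathcal{A}_n$ be the projection defined on the basis $S_{n+1}$ of $\mathbb{C}[S_{n+1}]$ by $$P_n(\tau)=\begin{cases}\tau & \text{if }\tau^{-1}(n+1)\in\{1,2,\dots,k_n,n+1\},\\ 0 & \text{if }\tau^{-1}(n+1)\in\{k_n+1,\dots,n\}.\end{cases}$$ Then $\frac{1}{\sqrt n}X_n$ and $P_n$ are asymptotically free as $n\to\infty$. That is, for each $n$ let $a_n,b_n$ be free random variables in some non-commutative probability space $(\mathcal{B}_n,\psi_n)$ such that $a_n$ has the same moments as $\frac{1}{\sqrt n}X_n$ and $b_n$ has the same moments as $P_n$ (with respect to $\varphi_n$). Then for every word $w(x,y)$ in two non-commuting letters $x,y$, $$\varphi_n\Big(w\big(\tfrac{1}{\sqrt n}X_n,P_n\big)\Big)-\psi_n\big(w(a_n,b_n)\big)\longrightarrow 0\qquad (n\to\infty).$$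
   Context: $S_n\subset S_{n+1}$ is the subgroup of permutations fixing $n+1$. A Young diagram with $n$ boxes is $A$-balanced if all its rows and columns have length at most $A\sqrt n$. The diagrams $\lambda_n$ have a limit shape if their profiles (boundary curves drawn in the Russian convention, as functions on $\mathbb{R}$), rescaled by $n^{-1/2}$ in both directions, converge uniformly as $n\to\infty$. For a finite-dimensional representation $\rho$, extended linearly to the group algebra, $\operatorname{tr}\rho$ denotes the normalized character: the trace divided by the dimension. The space $(\mathcal{A}_n,\varphi_n)$: put $\tau_0=e$ and $\tau_j=(j,n+1)$ for $1\le j\le n$. Every element of $S_{n+1}$ is uniquely of the form $\sigma\tau_j$ with $\sigma\in S_n$ and $0\le j\le n$. Hence an operator on $\mathbb{C}[S_{n+1}]$ is an $(n+1)\times(n+1)$ matrix of operators on $\mathbb{C}[S_n]$. $\mathcal{A}_n$ is the algebra of operators $T$ on $\mathbb{C}[S_{n+1}]$ whose matrix entries act by right multiplication by elements $t_{ij}\in\mathbb{C}[S_n]$, i.e. $T(x\tau_j)=\sum_{i=0}^n x\,t_{ij}\,\tau_i$ for all $x\in\mathbb{C}[S_n]$ and $0\le j\le n$ (so $\mathcal{A}_n$ corresponds to $\mathbb{C}[S_n]\otimes\operatorname{End}(\mathbb{C}^{n+1})$, with $\mathbb{C}[S_n]$ acting on the right). The state is $\varphi_n=\operatorname{tr}\rho_n\otimes\operatorname{tr}$, i.e. $\varphi_n(T)=\frac{1}{n+1}\sum_{i=0}^n\operatorname{tr}\rho_n(t_{ii})$. In this description $X_n$ has matrix entries $0$ on the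 diagonal, $e$ in positions $(0,j)$ and $(j,0)$ for $j\ge1$, and the transposition $(i,j)$ in position $(i,j)$ for distinct $i,j\ge1$. $P_n$ is the diagonal matrix with entries $e$ in the positions $0,1,\dots,k_n$ and $0$ in the positions $k_n+1,\dots,n$. *)

(* Defs.v *)
From HB Require Import structures.
From mathcomp Require Import all_boot all_order all_algebra all_fingroup.
From mathcomp Require Import mxrepresentation.
From mathcomp Require Import complex.
From mathcomp Require Import boolp classical_sets reals topology normedtype.

Set Implicit Arguments.
Unset Strict Implicit.
Unset Printing Implicit Defensive.

Import Order.TTheory GRing.Theory Num.Theory.
Import numFieldNormedType.Exports.

Local Open Scope ring_scope.

(** Permutations of 'I_n.  MathComp multiplies permutations from left to right,
    [(s * t) x = t (s x)]; all products of permutations below are compositions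
    of functions, [(s \oP t) x = s (t x)]. *)

Definition pcomp (n : nat) (s t : 'S_n) : 'S_n := (t * s)%g.
Notation "s \oP t" := (pcomp s t) (at level 40, left associativity).

Lemma pcompE n (s t : 'S_n) x : (s \oP t) x = s (t x).
Proof. exact: permM. Qed.

(** S_n inside S_(n+1), the stabiliser of the last point [ord_max]. *)
Definition emb_perm (n : nat) (s : 'S_n) : 'S_n.+1 := lift_perm ord_max ord_max s.

Lemma emb_permM n (s t : 'S_n) : emb_perm (s \oP t) = emb_perm s \oP emb_perm t.
Proof. by rewrite /emb_perm /pcomp lift_permM. Qed.

(** tau 0 = e and tau j = (j, n+1) for 1 <= j <= n, where the point j of
    {1, ..., n+1} is the ordinal of value j - 1. *)
Definition tau (n : nat) (j : 'I_n.+1) : 'S_n.+1 :=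
  if unlift ord0 j is Some i then tperm (lift ord_max i) ord_max else 1%g.

(** The group algebra of S_n; its product is convolution with respect to [\oP]. *)
Definition galg (F : fieldType) (n : nat) : Type := {ffun 'S_n -> F^o}.

Section GroupAlgebra.
Variables (F : fieldType) (n : nat).
Local Notation galg := (galg F n).

HB.instance Definition _ := Vector.copy galg {ffun 'S_n -> F^o}.

Implicit Types f g h : galg.

Definition gcoef f (s : 'S_n) : F := (f : {ffun 'S_n -> F^o}) s.

Definition gbase (s : 'S_n) : galg := [ffun t => (t == s)%:R].

Definition gmul f g : galg :=
  \sum_s \sum_t (gcoef f s * gcoef g t) *: gbase (s \oP t).

Lemma galgP f g : (forall s, gcoef f s = gcoef g s) -> f = g.
Proof. by move=> fg; apply/ffunP. Qed.

Lemma gcoefD f g s : gcoef (f + g) s = gcoef f s + gcoef g s.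
Proof. exact: ffunE. Qed.

Lemma gcoefZ a f s : gcoef (a *: f) s = a * gcoef f s.
Proof. exact: ffunE. Qed.

Lemma gcoef0 s : gcoef 0 s = 0.
Proof. exact: ffunE. Qed.

Lemma gcoef_base s t : gcoef (gbase s) t = (t == s)%:R.
Proof. exact: ffunE. Qed.

Lemma gcoef_sum I r (P : pred I) (E : I -> galg) s :
  gcoef (\sum_(i <- r | P i) E i) s = \sum_(i <- r | P i) gcoef (E i) s.
Proof.
by elim/big_rec2: _ => [|i y x _ <-]; rewrite ?gcoef0 ?gcoefD.
Qed.

Lemma galg_sum f : f = \sum_s gcoef f s *: gbase s.
Proof.
apply: galgP => s; rewrite gcoef_sum (bigD1 s) //= gcoefZ gcoef_base eqxx mulr1.
by rewrite big1 ?addr0 // => t /negPf ts; rewrite gcoefZ gcoef_base eq_sym ts mulr0.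
Qed.

Lemma gcoef_mul f g u :
  gcoef (gmul f g) u = \sum_s gcoef f s * gcoef g (s^-1%g \oP u).
Proof.
rewrite gcoef_sum; apply: eq_bigr => s _.
rewrite gcoef_sum (bigD1 (s^-1%g \oP u)) //= gcoefZ gcoef_base.
rewrite /pcomp mulgKV eqxx mulr1 big1 ?addr0 // => t ts.
rewrite gcoefZ gcoef_base; case: eqP => [us|]; last by rewrite mulr0.
by move: ts; rewrite us mulgK eqxx.
Qed.

Fact gmulA : associative gmul.
Proof.
move=> f g h; apply: galgP => u; rewrite !gcoef_mul.
under eq_bigr do rewrite gcoef_mul mulr_sumr.
under [RHS]eq_bigr do rewrite gcoef_mul mulr_suml.
rewrite [RHS]exchange_big /=; apply: eq_bigr => s _.
rewrite [RHS](reindex_inj (mulIg s)) /=; apply: eq_bigr => t _.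
by rewrite mulrA /pcomp mulgK invMg mulgA.
Qed.

Fact gmul1 : left_id (gbase 1%g) gmul.
Proof.
move=> f; apply: galgP => u; rewrite gcoef_mul (bigD1 1%g) //= gcoef_base eqxx.
rewrite mul1r /pcomp invg1 mulg1 big1 ?addr0 // => s /negPf s1.
by rewrite gcoef_base s1 mul0r.
Qed.

Fact gmulr1 : right_id (gbase 1%g) gmul.
Proof.
move=> f; apply: galgP => u; rewrite gcoef_mul (bigD1 u) //= gcoef_base.
rewrite /pcomp mulgV eqxx mulr1 big1 ?addr0 // => s su.
rewrite gcoef_base; case: eqP => [us|]; last by rewrite mulr0.
by move: su; rewrite -(mulgKV s u) us mul1g eqxx.
Qed.

Fact gmulDl : left_distributive gmul +%R.
Proof.
move=> f g h; apply: galgP => u; rewrite gcoefD !gcoef_mul -big_split /=.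
by apply: eq_bigr => s _; rewrite gcoefD mulrDl.
Qed.

Fact gmulDr : right_distributive gmul +%R.
Proof.
move=> f g h; apply: galgP => u; rewrite gcoefD !gcoef_mul -big_split /=.
by apply: eq_bigr => s _; rewrite gcoefD mulrDr.
Qed.

Fact gbase1_neq0 : gbase 1%g != 0.
Proof.
apply/eqP => /(congr1 (fun f => gcoef f 1%g)) /eqP.
by rewrite gcoef_base eqxx gcoef0 oner_eq0.
Qed.

HB.instance Definition _ := GRing.Zmodule_isNzRing.Build galg
  gmulA gmul1 gmulr1 gmulDl gmulDr gbase1_neq0.

Fact galg_scaleAl (a : F) f g : a *: (f * g) = (a *: f) * g.
Proof.
apply: galgP => u; rewrite gcoefZ !gcoef_mul mulr_sumr.
by apply: eq_bigr => s _; rewrite gcoefZ mulrA.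
Qed.

HB.instance Definition _ := GRing.Lmodule_isLalgebra.Build F galg galg_scaleAl.

Fact galg_scaleAr (a : F) f g : a *: (f * g) = f * (a *: g).
Proof.
apply: galgP => u; rewrite gcoefZ !gcoef_mul mulr_sumr.
by apply: eq_bigr => s _; rewrite gcoefZ mulrCA.
Qed.

HB.instance Definition _ := GRing.Lalgebra_isAlgebra.Build F galg galg_scaleAr.

Lemma gbaseM s t : gbase s * gbase t = gbase (s \oP t).
Proof.
apply: galgP => u; rewrite gcoef_mul (bigD1 s) //= !gcoef_base eqxx mul1r.
rewrite big1 ?addr0 => [|v /negPf vs]; last by rewrite gcoef_base vs mul0r.
congr ((nat_of_bool _)%:R); rewrite /pcomp; apply/eqP/eqP => [<-|->].
  by rewrite mulgKV.
by rewrite mulgK.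
Qed.

Lemma gbase1 : gbase 1%g = 1. Proof. by []. Qed.

Definition lin_ext (V : lmodType F) (h : 'S_n -> V) f : V :=
  \sum_s gcoef f s *: h s.

Fact lin_ext_is_linear (V : lmodType F) (h : 'S_n -> V) : linear (lin_ext h).
Proof.
move=> a f g; rewrite /lin_ext scaler_sumr -big_split /=; apply: eq_bigr => s _.
by rewrite gcoefD gcoefZ scalerDl scalerA.
Qed.

HB.instance Definition _ (V : lmodType F) (h : 'S_n -> V) :=
  GRing.isLinear.Build F galg V _ (lin_ext h) (lin_ext_is_linear h).

Lemma lin_ext_base (V : lmodType F) (h : 'S_n -> V) s : lin_ext h (gbase s) = h s.
Proof.
rewrite /lin_ext (bigD1 s) //= gcoef_base eqxx scale1r big1 ?addr0 // => t.
by move=> /negPf ts; rewrite gcoef_base ts scale0r.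
Qed.

End GroupAlgebra.

Definition emb (F : fieldType) (n : nat) : galg F n -> galg F n.+1 :=
  lin_ext (fun s => gbase F (emb_perm s)).

Section Cosets.
Variable n : nat.
Implicit Types (s : 'S_n) (j : 'I_n.+1) (u : 'S_n.+1).

Lemma emb_perm_inj : injective (@emb_perm n).
Proof.
move=> s t st; apply/permP => i; apply: (@lift_inj _ ord_max).
by move/permP: st => /(_ (lift ord_max i)); rewrite !lift_perm_lift.
Qed.

Lemma emb_permV s : (emb_perm s)^-1%g = emb_perm s^-1%g.
Proof. by rewrite /emb_perm lift_permV. Qed.

Lemma tauK j : tau j \oP tau j = 1%g.
Proof. by rewrite /tau /pcomp; case: unlift => [i|]; rewrite ?tperm2 ?mulg1. Qed.

Lemma tau_max j :
  tau j ord_max = if unlift ord0 j is Some i then lift ord_max i else ord_max.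
Proof. by rewrite /tau; case: unlift => [i|]; rewrite ?tpermR ?perm1. Qed.

Lemma tau_max_inj : injective (fun j => tau j ord_max).
Proof.
move=> i j; rewrite !tau_max.
case: unliftP => [i' ->|->]; case: unliftP => [j' ->|->] //.
- by move/lift_inj ->.
- by move/eqP; rewrite eq_sym (negPf (neq_lift _ _)).
- by move/eqP; rewrite (negPf (neq_lift _ _)).
Qed.

Lemma coset_maxV s j : (emb_perm s \oP tau j)^-1%g ord_max = tau j ord_max.
Proof.
apply: (canLR (permK _)); rewrite pcompE -(pcompE (tau j)) tauK perm1.
by rewrite /emb_perm lift_perm_id.
Qed.

Lemma coset_inj : injective (fun p : 'S_n * 'I_n.+1 => emb_perm p.1 \oP tau p.2).
Proof.
move=> [s i] [t j] /= e.
have ij : i = j by apply: tau_max_inj => /=; rewrite -(coset_maxV s) e coset_maxV.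
by rewrite ij in e *; congr (_, _); apply: emb_perm_inj; apply: (mulgI (tau j)).
Qed.

Lemma coset_bij : bijective (fun p : 'S_n * 'I_n.+1 => emb_perm p.1 \oP tau p.2).
Proof.
apply: inj_card_bij; first exact: coset_inj.
by rewrite card_prod !card_Sn card_ord factS mulnC.
Qed.

End Cosets.

Section Operators.
Variables (F : fieldType) (n : nat).
Local Notation V := (galg F n.+1).
Implicit Types (T : 'End(V)) (x : galg F n) (t : 'M[galg F n]_n.+1).

Lemma emb_base (s : 'S_n) : emb (gbase F s) = gbase F (emb_perm s).
Proof. exact: lin_ext_base. Qed.

HB.instance Definition _ := GRing.Linear.on (@emb F n).

Lemma embE x : emb x = \sum_s gcoef x s *: gbase F (emb_perm s).
Proof. by []. Qed.

Lemma embM : {morph @emb F n : x y / x * y}.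
Proof.
move=> x y; rewrite [in LHS](galg_sum x) mulr_suml linear_sum /=.
rewrite (embE x) mulr_suml; apply: eq_bigr => s _ /=.
rewrite -!scalerAl linearZ /=; congr (_ *: _).
rewrite [in LHS](galg_sum y) mulr_sumr linear_sum /=.
rewrite (embE y) mulr_sumr; apply: eq_bigr => t _ /=.
rewrite -!scalerAr linearZ /=; congr (_ *: _).
by rewrite !gbaseM emb_base emb_permM.
Qed.

Lemma emb1 : emb 1 = 1 :> V.
Proof. by rewrite -gbase1 emb_base /emb_perm lift_perm1. Qed.

Definition has_entries T t : Prop :=
  forall (x : galg F n) (j : 'I_n.+1),
    T (emb x * gbase F (tau j)) = \sum_i emb (x * t i j) * gbase F (tau i).

(** The coefficient of tau_i, as an element of C[S_n], of an element of
    C[S_(n+1)] written in the basis of the sigma tau_i. *)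
Definition component (i : 'I_n.+1) (f : V) : galg F n :=
  [ffun s => gcoef f (emb_perm s \oP tau i)].

Definition entry T (i j : 'I_n.+1) : galg F n := component i (T (gbase F (tau j))).

Lemma componentE i f s : gcoef (component i f) s = gcoef f (emb_perm s \oP tau i).
Proof. exact: ffunE. Qed.

Lemma component_sum (f : V) : f = \sum_i emb (component i f) * gbase F (tau i).
Proof.
rewrite [LHS]galg_sum.
have [g gK Kg] := coset_bij n.
rewrite (reindex (fun p : 'S_n * 'I_n.+1 => emb_perm p.1 \oP tau p.2)); last first.
  by exists g => p _; [apply: gK | apply: Kg].
rewrite -(pair_bigA _ (fun s i => gcoef f (emb_perm s \oP tau i) *:
  gbase F (emb_perm s \oP tau i))) exchange_big /=; apply: eq_bigr => i _.
rewrite /emb /lin_ext mulr_suml; apply: eq_bigr => s _.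
by rewrite -scalerAl gbaseM componentE.
Qed.

Lemma component_coset x i j :
  component i (emb x * gbase F (tau j)) = if i == j then x else 0.
Proof.
apply: galgP => s; rewrite componentE embE mulr_suml gcoef_sum.
under eq_bigr do rewrite -scalerAl gbaseM gcoefZ gcoef_base.
have e u : (emb_perm s \oP tau i == emb_perm u \oP tau j) = (u == s) && (i == j).
  apply/eqP/andP => [/(@coset_inj n (s, i) (u, j)) [-> ->]|[/eqP-> /eqP->]] //.
under eq_bigr do rewrite e; rewrite (bigD1 s) //= eqxx /=.
rewrite big1 => [|u /negPf ->]; last by rewrite mulr0.
by rewrite addr0; case: eqP; rewrite ?mulr1 ?mulr0 ?gcoef0.
Qed.

Lemma componentD i : {morph component i : f g / f + g}.
Proof. by move=> f g; apply: galgP => s; rewrite gcoefD !componentE gcoefD. Qed.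

Lemma componentZ i a : {morph component i : f / a *: f}.
Proof. by move=> f; apply: galgP => s; rewrite gcoefZ !componentE gcoefZ. Qed.

Lemma component0 i : component i 0 = 0.
Proof. by apply: galgP => s; rewrite componentE !gcoef0. Qed.

Lemma has_entriesE T t : has_entries T t -> forall i j, entry T i j = t i j.
Proof.
move=> Tt i j; rewrite /entry -[gbase F (tau j)]mul1r -emb1 Tt.
rewrite (big_morph _ (componentD i) (component0 i)) (bigD1 i) //=.
rewrite component_coset eqxx mul1r big1 ?addr0 // => k /negPf ki.
by rewrite component_coset eq_sym ki.
Qed.

End Operators.

(** The algebra A_n.  The product is composition in the usual order, unlike the
    library's ring structure on ['End(_)], where [f * g] is f followed by g. *)
Section OperatorAlgebra.
Variables (F : fieldType) (n : nat).
Local Notation V := (galg F n.+1).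

Definition opalg_pred : {pred 'End(V)} := [pred T | `[< exists t, has_entries T t >]].

Lemma opalg_predP (T : 'End(V)) :
  reflect (exists t, has_entries T t) (T \in opalg_pred).
Proof. exact: asboolP. Qed.

Record opalg := OpAlg { op :> 'End(V); op_entries : op \in opalg_pred }.

HB.instance Definition _ := [isSub for op].
HB.instance Definition _ := [Choice of opalg by <:].

Fact opalg_submod_closed : submod_closed opalg_pred.
Proof.
split=> [|a T S /opalg_predP[t Tt] /opalg_predP[s Ss]]; apply/opalg_predP.
  exists 0 => x j; rewrite lfunE big1 // => i _.
  by rewrite mxE mulr0 linear0 mul0r.
exists (\matrix_(i, j) (a *: t i j + s i j)) => x j.
rewrite !lfunE /= lfunE /= Tt Ss scaler_sumr -big_split /=.
by apply: eq_bigr => i _; rewrite mxE mulrDr -scalerAr linearP mulrDl -scalerAl.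
Qed.

HB.instance Definition _ :=
  GRing.isSubmodClosed.Build F _ opalg_pred opalg_submod_closed.
HB.instance Definition _ := [SubChoice_isSubLmodule of opalg by <:].

Fact opalg1_proof : \1%VF \in opalg_pred.
Proof.
apply/opalg_predP; exists 1%:M => x j; rewrite lfunE /= (bigD1 j) //= mxE eqxx.
rewrite mulr1 big1 ?addr0 // => i /negPf ij.
by rewrite mxE ij mulr0n mulr0 linear0 mul0r.
Qed.

Fact opalg_mul_proof (T S : opalg) : (T \o S)%VF \in opalg_pred.
Proof.
case: T S => [T /= /opalg_predP[t Tt]] [S /= /opalg_predP[s Ss]].
apply/opalg_predP; exists (\matrix_(i, j) \sum_k s k j * t i k) => x j.
rewrite comp_lfunE Ss linear_sum /=.
under eq_bigr do rewrite Tt; rewrite exchange_big /=; apply: eq_bigr => i _.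
rewrite mxE mulr_sumr linear_sum mulr_suml.
by apply: eq_bigr => k _; rewrite mulrA.
Qed.

Definition opalg_one := OpAlg opalg1_proof.
Definition opalg_mul (T S : opalg) := OpAlg (opalg_mul_proof T S).

Fact opalg_mulA : associative opalg_mul.
Proof. by move=> T S U; apply: val_inj; apply: comp_lfunA. Qed.
Fact opalg_mul1 : left_id opalg_one opalg_mul.
Proof. by move=> T; apply: val_inj; apply: comp_lfun1l. Qed.
Fact opalg_mulr1 : right_id opalg_one opalg_mul.
Proof. by move=> T; apply: val_inj; apply: comp_lfun1r. Qed.
Fact opalg_mulDl : left_distributive opalg_mul +%R.
Proof. by move=> T S U; apply: val_inj; apply: comp_lfunDl. Qed.
Fact opalg_mulDr : right_distributive opalg_mul +%R.
Proof. by move=> T S U; apply: val_inj; apply: comp_lfunDr. Qed.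
Fact opalg1_neq0 : opalg_one != 0.
Proof.
apply/eqP => /(congr1 (fun T : opalg => T 1)) /eqP.
by rewrite !lfunE /= oner_eq0.
Qed.

HB.instance Definition _ := GRing.Zmodule_isNzRing.Build opalg
  opalg_mulA opalg_mul1 opalg_mulr1 opalg_mulDl opalg_mulDr opalg1_neq0.

Fact opalg_scaleAl (a : F) (T S : opalg) : a *: (T * S) = (a *: T) * S.
Proof. by apply: val_inj; apply: comp_lfunZl. Qed.
HB.instance Definition _ := GRing.Lmodule_isLalgebra.Build F opalg opalg_scaleAl.

Fact opalg_scaleAr (a : F) (T S : opalg) : a *: (T * S) = T * (a *: S).
Proof. by apply: val_inj; apply: comp_lfunZr. Qed.
HB.instance Definition _ := GRing.Lalgebra_isAlgebra.Build F opalg opalg_scaleAr.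

Lemma opalgME (T S : opalg) f : (T * S) f = T (S f).
Proof. exact: comp_lfunE. Qed.

Lemma entryP (T : opalg) : has_entries T (\matrix_(i, j) entry T i j).
Proof.
have /opalg_predP[t Tt] := op_entries T.
move=> x j; rewrite Tt; apply: eq_bigr => i _.
by rewrite mxE (has_entriesE Tt).
Qed.

End OperatorAlgebra.

Section JucysMurphy.
Variables (F : fieldType) (n : nat).
Local Notation V := (galg F n.+1).

Definition jucys_murphy : V :=
  \sum_(i < n) gbase F (tperm (lift ord_max i) ord_max).

Definition X_lfun : 'End(V) := linfun (jucys_murphy \*o @idfun V).

Definition X_mx : 'M[galg F n]_n.+1 :=
  \matrix_(i, j) if i == j then 0 else
    match unlift ord0 i, unlift ord0 j with
    | Some a, Some b => gbase F (tperm a b)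
    | _, _ => 1
    end.

Lemma tau0 : tau (ord0 : 'I_n.+1) = 1%g.
Proof. by rewrite /tau unlift_none. Qed.

Lemma tau_lift (i : 'I_n) : tau (lift ord0 i) = tperm (lift ord_max i) ord_max.
Proof. by rewrite /tau liftK. Qed.

Lemma jucys_murphyC (x : galg F n) : jucys_murphy * emb x = emb x * jucys_murphy.
Proof.
rewrite embE mulr_sumr mulr_suml; apply: eq_bigr => s _.
rewrite -scalerAl -scalerAr; congr (_ *: _).
rewrite mulr_suml mulr_sumr (reindex_inj (@perm_inj _ s)) /=.
apply: eq_bigr => i _; rewrite !gbaseM; congr (gbase _ _).
rewrite /pcomp [RHS]conjgC tpermJ; congr (_ * tperm _ _)%g.
  by rewrite /emb_perm lift_perm_lift.
by rewrite /emb_perm lift_perm_id.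
Qed.

Lemma emb_tperm (a b : 'I_n) :
  emb_perm (tperm a b) = tperm (lift ord_max a) (lift ord_max b).
Proof.
apply/permP => x; case: (unliftP ord_max x) => [y|] ->.
  rewrite /emb_perm lift_perm_lift; case: tpermP => [->|->|ya yb].
  - by rewrite tpermL.
  - by rewrite tpermR.
  - by rewrite tpermD //; apply/eqP => /lift_inj e; [apply: ya|apply: yb].
by rewrite /emb_perm lift_perm_id tpermD // eq_sym neq_lift.
Qed.

Lemma X_entries : has_entries X_lfun X_mx.
Proof.
move=> x j; rewrite lfunE /= mulrA jucys_murphyC -mulrA.
under eq_bigr do rewrite embM -mulrA; rewrite -mulr_sumr; congr (_ * _).
rewrite big_ord_recl /= tau0 !mxE unlift_none.
case: (unliftP ord0 j) => [k|] ->; last first.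
  rewrite eqxx linear0 mul0r add0r tau0 gbase1 mulr1; apply: eq_bigr => i _.
  by rewrite mxE eq_sym (negPf (neq_lift _ _)) liftK unlift_none emb1 mul1r tau_lift.
rewrite (negPf (neq_lift _ _)) gbase1 mulr1 emb1 mulr_suml (bigD1 k) //=.
rewrite tau_lift gbaseM -tau_lift tauK gbase1; congr (_ + _).
rewrite [RHS](bigD1 k) //= mxE eqxx linear0 mul0r add0r; apply: eq_bigr => i ik.
rewrite mxE (inj_eq lift_inj) (negPf ik) !liftK emb_base !gbaseM !tau_lift.
congr (gbase _ _); rewrite /pcomp conjgC tpermJ tpermR tpermD ?neq_lift //.
  by congr (_ * _)%g; rewrite emb_tperm tpermC.
by rewrite (inj_eq lift_inj).
Qed.

Fact X_proof : X_lfun \in @opalg_pred F n.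
Proof. by apply/opalg_predP; exists X_mx; apply: X_entries. Qed.

Definition Xop : opalg F n := OpAlg X_proof.

End JucysMurphy.

(** P_n, with k_n = k; the point ord_max is n+1, and the points 1, ..., k are
    the ordinals of value < k. *)
Section Projection.
Variables (F : fieldType) (n k : nat).
Local Notation V := (galg F n.+1).

Definition P_kept (t : 'S_n.+1) : bool :=
  let p := (t^-1)%g ord_max in (p < k)%N || (p == ord_max).

Definition P_lfun : 'End(V) :=
  linfun (lin_ext (fun t : 'S_n.+1 => if P_kept t then gbase F t else 0)).

Definition P_mx : 'M[galg F n]_n.+1 :=
  \matrix_(i, j) if (i == j) && (i <= k)%N then 1 else 0.

Lemma P_kept_coset (s : 'S_n) j : P_kept (emb_perm s \oP tau j) = (j <= k)%N.
Proof.
rewrite /P_kept /= coset_maxV tau_max; case: (unliftP ord0 j) => [i|] ->.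
  rewrite eq_sym (negPf (neq_lift _ _)) orbF /= /bump leq0n add1n.
  by rewrite (leqNgt n i) (ltn_ord i).
by rewrite eqxx orbT.
Qed.

Lemma P_entries : has_entries P_lfun P_mx.
Proof.
move=> x j; rewrite (bigD1 j) //= big1 => [|i /negPf ij]; last first.
  by rewrite mxE ij mulr0 linear0 mul0r.
rewrite addr0 mxE eqxx lfunE /= embE mulr_suml linear_sum /=.
have -> : x * (if (j <= k)%N then 1 else 0) = (if (j <= k)%N then 1 else 0) *: x.
  by case: ifP; rewrite ?mulr1 ?mulr0 ?scale1r ?scale0r.
rewrite linearZ /= embE scaler_sumr mulr_suml; apply: eq_bigr => s _.
rewrite -!scalerAl gbaseM linearZ /= lin_ext_base P_kept_coset.
by case: ifP; rewrite ?scale1r ?scale0r ?scaler0.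
Qed.

Fact P_proof : P_lfun \in @opalg_pred F n.
Proof. by apply/opalg_predP; exists P_mx; apply: P_entries. Qed.

Definition Pop : opalg F n := OpAlg P_proof.

End Projection.

(** A [mx_representation] acts on row vectors from the right, so for the
    product [*] of MathComp it is a homomorphism, and for [\oP] the action on
    row vectors is a left action; the trace is the same on both readings. *)
Section State.
Variables (F : fieldType) (n d : nat).
Variable rho : mx_representation F [set: 'S_n]%G d.

Definition norm_char (x : galg F n) : F := (\sum_s gcoef x s * \tr (rho s)) / d%:R.

Definition phi (T : opalg F n) : F :=
  n.+1%:R^-1 * \sum_(i < n.+1) norm_char (entry T i i).

End State.

Section StateTheory.
Variables (F : numFieldType) (n d : nat).
Variable rho : mx_representation F [set: 'S_n]%G d.

Lemma norm_char_is_scalar : scalar (norm_char rho).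
Proof.
move=> a x y; rewrite /norm_char mulrA -mulrDl mulr_sumr -big_split /=.
congr (_ / _); apply: eq_bigr => s _.
by rewrite gcoefD gcoefZ mulrDl mulrA.
Qed.

Lemma phi_is_scalar : scalar (phi rho).
Proof.
move=> a T S; rewrite /phi mulrCA -mulrDr; congr (_ * _).
rewrite mulr_sumr -big_split; apply: eq_bigr => i _ /=.
rewrite -norm_char_is_scalar; congr (norm_char rho _).
by rewrite /entry lfunE /= lfunE /= componentD componentZ.
Qed.

HB.instance Definition _ :=
  GRing.isLinear.Build F (opalg F n) F _ (phi rho) phi_is_scalar.

Lemma phi1 : (0 < d)%N -> phi rho 1 = 1.
Proof.
move=> d0; rewrite /phi (eq_bigr (fun=> 1)) => [|i _].
  by rewrite sumr_const card_ord mulVf // pnatr_eq0.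
have -> : entry (1 : opalg F n) i i = 1.
  rewrite /entry lfunE /= -[gbase F _]mul1r -emb1 component_coset eqxx //.
rewrite /norm_char (bigD1 1%g) //= -gbase1 gcoef_base eqxx mul1r.
rewrite repr_mx1 mxtrace1 big1 => [|s /negPf s1]; last first.
  by rewrite gcoef_base s1 mul0r.
by rewrite addr0 divff // pnatr_eq0 -lt0n.
Qed.

End StateTheory.

(** A diagram is the sequence of its row lengths; the box of row i and column j
    (counted from 0) is present when j < nth 0 la i. *)

Definition young_diagram (n : nat) (la : seq nat) : bool :=
  [&& sorted geq la, 0 \notin la & sumn la == n]%N.

Definition col_length (la : seq nat) (j : nat) : nat := count (ltn j) la.

Section Specht.
Variables (F : fieldType) (n : nat) (la : seq nat).

(** The boxes are numbered 0, ..., n-1 row by row: the box of number k lies in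
    row [reshape_index la k] and column [reshape_offset la k]. *)
Definition row_stab : {set 'S_n} :=
  [set p : 'S_n | [forall k : 'I_n, reshape_index la (p k) == reshape_index la k]].
Definition col_stab : {set 'S_n} :=
  [set q : 'S_n | [forall k : 'I_n, reshape_offset la (q k) == reshape_offset la k]].

Definition young_symmetrizer : galg F n :=
  (\sum_(p in row_stab) gbase F p) * (\sum_(q in col_stab) (-1) ^+ q *: gbase F q).

Definition galg_row (f : galg F n) : 'rV[F]_#|[set: 'S_n]| :=
  \sum_s gcoef f s *: delta_mx 0 (gring_index [set: 'S_n]%G s).

(** The Specht module C[S_n] c_la.  [regular_repr] is right multiplication for
    [*], hence left multiplication for [\oP]. *)
Definition specht_repr :=
  submod_repr (cyclic_mx_module (regular_repr F [set: 'S_n]%G)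
    (galg_row young_symmetrizer)).

Definition irrep_of_shape (d : nat) (rho : mx_representation F [set: 'S_n]%G d) : Prop :=
  mx_irreducible rho /\ mx_rsim rho specht_repr.

End Specht.

(** A word in x, y is a sequence of booleans: true for x and false for y. *)
Definition word_eval (B : pzRingType) (w : seq bool) (x y : B) : B :=
  \prod_(c <- w) (if c then x else y).

Definition same_moments (F : fieldType) (A B : algType F)
    (phi : A -> F) (x : A) (psi : B -> F) (y : B) : Prop :=
  forall m : nat, phi (x ^+ m) = psi (y ^+ m).

(** The unital subalgebras F[a] and F[b] are free: alternating products of
    centered elements are centered.  The boolean tells the subalgebra. *)
Definition free_pair (F : fieldType) (B : algType F) (psi : B -> F) (a b : B) : Prop :=
  forall s : seq (bool * B),
    s != [::] ->
    sorted (fun u v => u.1 != v.1) s ->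
    (forall u, u \in s ->
       (exists p : {poly F}, u.2 = horner_alg (if u.1 then a else b) p) /\
       psi u.2 = 0) ->
    psi (\prod_(u <- s) u.2) = 0.

Local Open Scope classical_set_scope.

Section LimitShape.
Variable R : realType.

Definition balanced (A : R) (n : nat) (la : seq nat) : Prop :=
  (forall i, (nth 0%N la i)%:R <= A * Num.sqrt n%:R) /\
  (forall j, (col_length la j)%:R <= A * Num.sqrt n%:R).

(** The union of the closed boxes [j, j+1] x [i, i+1] of the diagram and of the
    two coordinate half-axes. *)
Definition diagram_region (la : seq nat) : set (R * R) :=
  [set p | [/\ 0 <= p.1, 0 <= p.2 &
    [\/ p.1 = 0, p.2 = 0 | exists i j : nat,
      [/\ (j < nth 0 la i)%N, j%:R <= p.1 <= j.+1%:R & i%:R <= p.2 <= i.+1%:R]]]].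

(** The profile in the Russian coordinates u = x - y, v = x + y: the highest
    point of the region above u, which is |u| outside the diagram. *)
Definition profile (la : seq nat) (u : R) : R :=
  sup [set v | exists p, [/\ diagram_region la p, p.1 - p.2 = u & p.1 + p.2 = v]].

Definition scaled_profile (n : nat) (la : seq nat) (u : R) : R :=
  profile la (Num.sqrt n%:R * u) / Num.sqrt n%:R.

Definition has_limit_shape (la : nat -> seq nat) : Prop :=
  exists Omega : R -> R,
    {uniform, (fun n => scaled_profile n (la n)) @ \oo --> Omega}.

End LimitShape.

(* Main.v *)
From HB Require Import structures.
Require Import Defs.
From mathcomp Require Import all_boot all_order all_algebra all_fingroup.
From mathcomp Require Import mxrepresentation sesquilinear spectral.
From mathcomp Require Import complex.
From mathcomp Require Import boolp classical_sets reals topology normedtype.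
From mathcomp Require Import ring lra.

Set Implicit Arguments.
Unset Strict Implicit.
Unset Printing Implicit Defensive.

Import Order.TTheory GRing.Theory Num.Theory.
Import numFieldNormedType.Exports.

Local Open Scope ring_scope.

(** Apply the irreducible representation to the matrix entries: an element T of
    the algebra becomes an (n+1) x (n+1) matrix of operators [block i j T] on the
    space of the representation, and phi becomes the normalized trace.  The
    operator P has scalar diagonal blocks, hence so has any polynomial g(P).  For
    X the following holds.

    - Left multiplication by a power of the Jucys-Murphy element commutes with
      right multiplication by the coset representatives tau_j, so the diagonal
      blocks of a polynomial f(X) are all equal; they commute with S_n, hence by
      Schur's lemma they are the scalar phi(f(X)).  A centered f(X) therefore has
      zero diagonal, exactly and not just in the limit ([block_horner_x_diag]).

    - The eigenvalues of the Jucys-Murphy elements on a Specht module are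
      contents of boxes of the diagram ([specht_eigenvalue]), at most A sqrt n in
      absolute value.  The blocks of X off the diagonal are transpositions, or
      identities in row and column 0, and a recursion on p gives the bound
      (A+3)^p / sqrt n for the norm of every block of (X / sqrt n)^p off the
      diagonal ([x_bounds]).

    Consider now an alternating product with m >= 1 centered factors
    f_l(X / sqrt n), separated by centered factors g_l(P).  Its phi is the average
    over a first index of a sum over m - 1 further indices: a bounded scalar for the
    first index (from the factors in P at the two ends), a centered scalar for each
    of the others, and the normalized trace of a product of m blocks off the
    diagonal, which is O(n^(-m/2)).  That trace depends only on the orbit of the
    tuple of indices under permutations fixing the index 0.  So, in a sum against a
    centered scalar, the terms whose index differs from 0 and from all other indices
    can be traded for terms where it does not.  Each index with a centered scalar is
    thus glued to 0 or to another index, and a sum over m - 1 of them grows only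
    like n^((m-1)/2) ([tsum_bound]).  In total phi is O(n^(-1/2))
    ([alternating_poly_phi]), where freeness makes psi vanish.

    Finally every word is reduced to centered alternating products by subtracting
    means and by merging adjacent factors in the same variable; both operations
    act in the same way on the two sides, since the moments of the single
    variables agree ([asymptotic_freeness]). *)

(** * Sums of centered functions against an invariant function *)

Section TupleSums.
Variables (C : numClosedFieldType) (I : finType).

(** Nested sums instead of a sum over tuples, so that an induction can hand the
    first summation index over to F. *)
Fixpoint tsum (V : lmodType C) (gs : seq (I -> C)) (F : seq I -> V) : V :=
  if gs is g :: gs' then \sum_x g x *: tsum gs' (fun s => F (x :: s)) else F [::].

Lemma eq_tsum (V : lmodType C) gs (F F' : seq I -> V) :
  (forall s, size s = size gs -> F s = F' s) -> tsum gs F = tsum gs F'.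
Proof.
elim: gs F F' => [|g gs IH] F F' FF' /=; first exact: FF'.
by apply: eq_bigr => x _; congr (_ *: _); apply: IH => s sz; apply: FF'; rewrite /= sz.
Qed.

Lemma tsum_linear (V W : lmodType C) (h : {linear V -> W}) gs (F : seq I -> V) :
  h (tsum gs F) = tsum gs (fun s => h (F s)).
Proof.
elim: gs F => [|g gs IH] F //=.
by rewrite linear_sum; apply: eq_bigr => x _; rewrite linearZ /= IH.
Qed.

Lemma tsum_sum (V : lmodType C) (J : Type) (r : seq J) (P : pred J) gs (c : J -> C)
    (F : J -> seq I -> V) :
  tsum gs (fun s => \sum_(j <- r | P j) c j *: F j s) =
  \sum_(j <- r | P j) c j *: tsum gs (F j).
Proof.
elim: gs F => [|g gs IH] F //=.
under eq_bigr do rewrite IH scaler_sumr.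
rewrite exchange_big /=; apply: eq_bigr => j _.
rewrite scaler_sumr; apply: eq_bigr => x _.
by rewrite !scalerA mulrC.
Qed.

(** The effect of gluing a summation index that carries c to the l-th one; the
    product need not be centered, so its flag becomes false. *)
Fixpoint mul_at (c : I -> C) (gs : seq (bool * (I -> C))) (l : nat) :=
  match gs, l with
  | [::], _ => [::]
  | (_, g) :: gs', 0 => (false, fun x => c x * g x) :: gs'
  | g :: gs', l'.+1 => g :: mul_at c gs' l'
  end.

Lemma size_mul_at c gs l : size (mul_at c gs l) = size gs.
Proof. by elim: gs l => [|[f g] gs IH] [|l] //=; rewrite IH. Qed.

Lemma tsum_mul_at x0 c gs l (F : seq I -> C^o) : (l < size gs)%N ->
  tsum (map snd gs) (fun s => c (nth x0 s l) * F s : C^o) =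
  tsum (map snd (mul_at c gs l)) F.
Proof.
elim: gs l F => [|[f g] gs IH] [|l] F //= szl.
  apply: eq_bigr => x _.
  have /= := tsum_linear (c x \*: (@idfun C^o)) (map snd gs) (fun s => F (x :: s)).
  by move <-; rewrite scalerA mulrC.
apply: eq_bigr => x _; congr (_ *: _); exact: IH.
Qed.

(** Invariance under the permutations that fix b pointwise, tested on
    transpositions, which generate them. *)
Definition stab_invariant (b : seq I) (F : seq I -> C) : Prop :=
  forall x y, x \notin b -> y \notin b -> forall s, F (map (tperm x y) s) = F s.

Lemma map_tperm_id (b : seq I) (x y : I) :
  x \notin b -> y \notin b -> map (tperm x y) b = b.
Proof.
move=> xb yb; apply: map_id_in => z zb.
by rewrite tpermD //; [apply: contraNneq xb | apply: contraNneq yb] => ->.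
Qed.

(** A point that occurs several times in t is counted at its first position. *)
Lemma sum_mem_nth x0 (t : seq I) (G : I -> C) :
  \sum_(x in t) G x =
  \sum_(l < size t) (index (nth x0 t l) t == l)%:R * G (nth x0 t l).
Proof.
transitivity (\sum_x \sum_(l < size t) (index x t == l)%:R * G x).
  rewrite big_mkcond /=; apply: eq_bigr => x _; rewrite -mulr_suml.
  case: ifPn => xt.
    have xlt : (index x t < size t)%N by rewrite index_mem.
    rewrite (bigD1 (Ordinal xlt)) //= eqxx big1 ?addr0 ?mul1r // => l.
    by rewrite eq_sym; move/eqP=> lx; case: eqP => // e; case: lx; apply/val_inj.
  rewrite big1 ?mul0r // => l _; rewrite (memNindex xt).
  by case: eqP => // e; have := ltn_ord l; rewrite -e ltnn.
rewrite exchange_big /=; apply: eq_bigr => l _.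
rewrite (bigD1 (nth x0 t l)) //= big1 ?addr0 // => x xl.
case: eqP => [e|]; last by rewrite mul0r.
by move: xl; rewrite -e nth_index ?eqxx // -index_mem e.
Qed.

(** The flag true marks a centered function.  With r the square root of the number
    of points, a sum against a centered function costs r, against any other one
    r ^+ 2. *)
Definition weight (r : C) (gs : seq (bool * (I -> C))) : C :=
  \prod_(g <- gs) (if g.1 then r else r ^+ 2).

Definition summand_ok (g : bool * (I -> C)) : Prop :=
  (forall x, `|g.2 x| <= 1) /\ (g.1 -> \sum_x g.2 x = 0).

Lemma weight_ge0 r gs : 1 <= r -> 0 <= weight r gs.
Proof.
move=> r1; have r0 : 0 <= r by apply: le_trans r1.
by apply: prodr_ge0 => g _; case: ifP; rewrite ?exprn_ge0.
Qed.

Lemma weight_mul_at r c gs l : 1 <= r -> (l < size gs)%N ->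
  weight r (mul_at c gs l) <= r * weight r gs.
Proof.
move=> r1; have r0 : 0 <= r by apply: le_trans r1.
elim: gs l => [|[f g] gs IH] [|l] //= szl; rewrite /weight !big_cons /=.
  rewrite mulrA ler_wpM2r ?weight_ge0 //; case: f => //.
  by rewrite ler_peMl // exprn_ge0.
rewrite mulrCA ler_wpM2l ?IH //.
by case: f; rewrite ?exprn_ge0.
Qed.

Fixpoint summands_ok (gs : seq (bool * (I -> C))) : Prop :=
  if gs is g :: gs' then summand_ok g /\ summands_ok gs' else True.

Lemma summands_ok_mul_at c gs l : (forall x, `|c x| <= 1) ->
  summands_ok gs -> summands_ok (mul_at c gs l).
Proof.
move=> c1; elim: gs l => [|[f g] gs IH] [|l] //= [[g1 gc] Ggs]; split=> //.
  by split=> // x /=; rewrite normrM mulr_ile1.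
exact: IH.
Qed.

Section FreshPoint.
Variables (b : seq I) (F : seq I -> C).
Hypothesis F_inv : stab_invariant b F.

(** The common value of F (x :: s) at all points x outside b and s; the default 0
    is taken when there are none. *)
Definition fresh_value (s : seq I) : C :=
  if [pick x | x \notin b ++ s] is Some x then F (x :: s) else 0.

(** Two fresh points are exchanged by a transposition that fixes b and s. *)
Lemma fresh_valueE x s : x \notin b ++ s -> F (x :: s) = fresh_value s.
Proof.
rewrite /fresh_value; case: pickP => [y|/(_ x) -> //].
rewrite !mem_cat !negb_or => /andP[yb ys] /andP[xb xs].
by rewrite -(F_inv xb yb) /= tpermL map_tperm_id.
Qed.

Lemma fresh_value_inv : stab_invariant b fresh_value.
Proof.
move=> x y xb yb s; rewrite {1}/fresh_value; case: pickP => [z|none].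
  rewrite -[z](tpermK x y) mem_cat negb_or => /andP[zb].
  rewrite mem_map; last exact: perm_inj.
  move=> zs; rewrite -map_cons F_inv // fresh_valueE // mem_cat negb_or zs andbT.
  by move: zb; rewrite -{1}(map_tperm_id xb yb) mem_map //; apply: perm_inj.
rewrite /fresh_value; case: pickP => // z zbs; exfalso.
have /negbFE := none (tperm x y z).
rewrite -(mem_map (@perm_inj _ (tperm x y))) tpermK -{1}(map_tperm_id xb yb) -map_cat.
rewrite (mapK (tpermK x y)).
by rewrite (negPf zbs).
Qed.

Definition fresh_defect (x : I) (s : seq I) : C := F (x :: s) - fresh_value s.

Lemma fresh_defect_inv x y z s : x \notin b -> y \notin b ->
  fresh_defect (tperm x y z) (map (tperm x y) s) = fresh_defect z s.
Proof. by move=> xb yb; rewrite /fresh_defect -map_cons F_inv // fresh_value_inv. Qed.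

Lemma fresh_defect_bound M x s : 0 <= M -> (forall s, `|F s| <= M) ->
  `|fresh_defect x s| <= 2 * M.
Proof.
move=> M0 FM; rewrite mulr_natl mulr2n (le_trans (ler_normB _ _)) // lerD //.
by rewrite /fresh_value; case: pickP => // _; rewrite normr0.
Qed.

(** Since c sums to zero, F (x :: s) can be replaced by its difference with the
    value at fresh points.  That difference vanishes at fresh points, so only the
    points of b and s are left. *)
Lemma centered_sum x0 (c : I -> C) s : \sum_x c x = 0 ->
  \sum_x c x * F (x :: s) =
  \sum_(l < size (b ++ s)) (index (nth x0 (b ++ s) l) (b ++ s) == l)%:R *
    (c (nth x0 (b ++ s) l) * fresh_defect (nth x0 (b ++ s) l) s).
Proof.
move=> c0; transitivity (\sum_x c x * fresh_defect x s).
  by under [RHS]eq_bigr do rewrite mulrBr; rewrite sumrB -mulr_suml c0 mul0r subr0.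
rewrite -(sum_mem_nth x0 _ (fun x => c x * fresh_defect x s)) [RHS]big_mkcond /=.
apply: eq_bigr => x _; case: ifPn => // xbs.
by rewrite /fresh_defect fresh_valueE // subrr mulr0.
Qed.

End FreshPoint.

(** Every summation index with a centered function is worth the square root of the
    number of points.  If the first function is not centered, its index x is added
    to the base points b and the sum is bounded trivially.  If it is centered, its
    index equals a base point, which only gains, or one of the other indices.  In
    that case two functions merge into one that may not be centered: a weight r
    (for the one that disappears) pays for the increase of the other from r to
    r ^+ 2.  There are at most size gs + size b such choices, and replacing F by
    [fresh_defect] at most doubles its bound, which explains the constant. *)
Lemma tsum_bound (r : C) : 1 <= r -> r ^+ 2 = #|I|%:R ->
  forall gs b (F : seq I -> C^o) M, summands_ok gs -> stab_invariant b F -> 0 <= M ->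
  (forall s, `|F s| <= M) ->
  `|tsum (map snd gs) F| <=
    ((2 * (size gs + size b)) ^ size gs)%:R * (M * weight r gs).
Proof.
move=> r1 rI gs; have [m] := ubnP (size gs).
elim: m gs => // m IH [|[f g] gs] /= szm b F M.
  by move=> _ _ M0 FM; rewrite /weight big_nil mulr1 mul1r.
move=> [[/= g1 gc] Ggs] F_inv M0 FM; have r0 : 0 <= r by apply: le_trans r1.
have W0 : 0 <= weight r gs by rewrite weight_ge0.
case: f gc => gc; last first.
  (* not centered: the index x becomes a base point *)
  rewrite /weight big_cons /= -/(weight r gs) rI.
  apply: (le_trans (ler_norm_sum _ _ _)).
  pose K : C := ((2 * (size gs + size b).+1) ^ size gs)%:R * (M * weight r gs).
  apply: (@le_trans _ _ (\sum_(x : I) K)).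
    apply: ler_sum => x _; rewrite normrM.
    rewrite -[leRHS]mul1r ler_pM //.
    have := IH gs szm (x :: b) (fun s => F (x :: s)) M Ggs.
    rewrite /= addnS; apply=> //= y z.
    rewrite !inE !negb_or => /andP[yx yb] /andP[zx zb] s.
    by rewrite -[RHS](F_inv _ _ yb zb) /= tpermD.
  rewrite sumr_const /= -(mulr_natr K) /K -!mulrA [_ * #|I|%:R]mulrC.
  rewrite ler_wpM2r ?mulr_ge0 ?ler0n // ler_nat addSn expnS.
  by rewrite leq_pmull // muln_gt0.
(* centered; x0 is a default value for nth *)
have [x0 _|I0] := pickP (fun _ : I => true); last first.
  rewrite big1 => [|x]; last by have := I0 x.
  by rewrite normr0 !mulr_ge0 ?weight_ge0.
pose t s := b ++ s.
pose q := (size b + size gs)%N.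
pose H (l : nat) (s : seq I) : C^o := (index (nth x0 (t s) l) (t s) == l)%:R *
    (g (nth x0 (t s) l) * fresh_defect b F (nth x0 (t s) l) s).
have -> : \sum_x g x *: tsum (map snd gs) (fun s => F (x :: s)) =
    \sum_(l < q) tsum (map snd gs) (H l).
  rewrite -tsum_sum.
  under [RHS]eq_bigr => l _ do rewrite -[tsum _ _]scale1r.
  rewrite -tsum_sum; apply: eq_tsum => s; rewrite size_map => szs.
  under [RHS]eq_bigr do rewrite scale1r.
  rewrite /q -szs -size_cat; exact: (centered_sum F_inv x0 s (gc isT)).
apply: (le_trans (ler_norm_sum _ _ _)).
pose K : C := ((2 * (size gs + size b)) ^ size gs)%:R * ((2 * M) * (r * weight r gs)).
have M20 : 0 <= 2 * M by rewrite mulr_ge0.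
apply: (@le_trans _ _ (\sum_(l < q) K)); last first.
  rewrite sumr_const card_ord /weight big_cons /= -/(weight r gs) /K -(mulr_natl _ q).
  rewrite mulrA -natrM -!mulrA mulrCA mulrA -natrM.
  rewrite ler_wpM2r ?mulr_ge0 // ler_nat addSn expnS mulnA leq_mul //.
    by rewrite leq_mul2l /= /q addnC.
  by have [->//|gs0] := posnP (size gs); rewrite leq_exp2r // leq_mul2l leqnSn orbT.
apply: ler_sum => l _.
have defect_inv := fresh_defect_inv F_inv.
have Hinv : forall x y, x \notin b -> y \notin b -> forall s,
    t (map (tperm x y) s) = map (tperm x y) (t s).
  by move=> x y xb yb s; rewrite /t map_cat (map_tperm_id xb yb).
have [lb|bl] := ltnP l (size b).
  (* the index equals a base point: one summation is lost *)
  apply: (le_trans (y := ((2 * (size gs + size b)) ^ size gs)%:R * ((2 * M) * weight r gs))).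
    apply: IH => // [x y xb yb s|s].
      rewrite /H Hinv // (nth_map x0) ?size_cat ?ltn_addr //.
      rewrite index_map; last exact: perm_inj.
      rewrite defect_inv //; congr (_ * (g _ * _)).
      have nb : nth x0 (t s) l \in b by rewrite /t nth_cat lb mem_nth.
      by rewrite tpermD //; [apply: contraNneq xb | apply: contraNneq yb] => ->.
    rewrite /H normrM normrM -[leRHS]mul1r ler_pM ?mulr_ge0 //.
      by case: eqP; rewrite ?normr0 ?normr1.
    by rewrite -[leRHS]mul1r ler_pM // fresh_defect_bound.
  rewrite /K ler_wpM2l ?ler0n // ler_wpM2l // ler_peMl //.
(* the index equals the k-th of the other ones *)
pose k := (l - size b)%N.
have kgs : (k < size gs)%N by rewrite /k ltn_subLR // (ltn_ord l).
pose H' (s : seq I) : C^o := (index (nth x0 (t s) l) (t s) == l)%:R *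
    fresh_defect b F (nth x0 s k) s *+ (k < size s)%N.
have -> : tsum (map snd gs) (H l) = tsum (map snd (mul_at g gs k)) H'.
  rewrite -(tsum_mul_at x0) //; apply: eq_tsum => s; rewrite size_map => szs.
  have e : nth x0 (t s) l = nth x0 s k by rewrite /t nth_cat ltnNge bl.
  by rewrite /H /H' e szs kgs mulrCA.
apply: (le_trans (y := ((2 * (size gs + size b)) ^ size gs)%:R *
    ((2 * M) * weight r (mul_at g gs k)))).
  rewrite -(size_mul_at g gs k); apply: IH; rewrite ?size_mul_at //.
  - exact: summands_ok_mul_at.
  - move=> x y xb yb s; rewrite /H' Hinv // size_map.
    case: (ltnP k (size s)) => ks; last by rewrite !mulr0n.
    have lt_ts : (l < size (t s))%N by rewrite size_cat -ltn_subLR.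
    rewrite (nth_map x0 _ _ lt_ts) (nth_map x0 _ _ ks) defect_inv // index_map //.
    exact: perm_inj.
  move=> s; rewrite /H'; case: (k < size s)%N; rewrite ?mulr0n ?normr0 // mulr1n.
  rewrite normrM -[leRHS]mul1r ler_pM // ?fresh_defect_bound //.
  by case: eqP; rewrite ?normr0 ?normr1.
by rewrite /K ler_wpM2l ?ler0n // ler_wpM2l // weight_mul_at.
Qed.

End TupleSums.

(** * Operator norms *)

Section OperatorBounds.
Local Open Scope sesquilinear_scope.
Variables (C : numClosedFieldType).

Definition rvnorm n (v : 'rV[C]_n) : C := sqrtC (dotmx v v).

Lemma rvnorm_ge0 n (v : 'rV[C]_n) : 0 <= rvnorm v.
Proof. by rewrite sqrtC_ge0 dnorm_ge0. Qed.

Lemma rvnormD n (u v : 'rV[C]_n) : rvnorm (u + v) <= rvnorm u + rvnorm v.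
Proof. by have [] := triangle_lerif (@dotmx C n) u v. Qed.

Lemma dotmx_self n (v : 'rV[C]_n) : dotmx v v = \sum_j `|v 0 j| ^+ 2.
Proof.
by rewrite dotmxE mxE; apply: eq_bigr => j _; rewrite !mxE normCK.
Qed.

Lemma rvnormZ n a (v : 'rV[C]_n) : rvnorm (a *: v) = `|a| * rvnorm v.
Proof.
rewrite /rvnorm !dotmx_self; under eq_bigr do rewrite mxE normrM exprMn.
by rewrite -mulr_sumr rootCMl ?exprn_ge0 // sqrCK.
Qed.

Lemma rvnorm0 n : rvnorm (0 : 'rV[C]_n) = 0.
Proof. by rewrite -(scale0r (0 : 'rV[C]_n)) rvnormZ normr0 mul0r. Qed.

Lemma entry_le_rvnorm n (v : 'rV[C]_n) j : `|v 0 j| <= rvnorm v.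
Proof.
rewrite -[leLHS]sqrCK // ler_sqrtC ?nnegrE ?exprn_ge0 //.
rewrite dotmx_self (bigD1 j) //= lerDl.
  by apply: sumr_ge0 => i _; rewrite exprn_ge0.
exact: dnorm_ge0.
Qed.

Lemma rvnorm_delta n (j : 'I_n) : rvnorm (delta_mx 0 j : 'rV[C]_n) = 1.
Proof.
rewrite /rvnorm dotmx_self (bigD1 j) //= mxE !eqxx normr1 expr1n big1 ?addr0 ?sqrtC1 //.
by move=> i /negPf ij; rewrite mxE ij andbF normr0 expr0n.
Qed.

Definition opbound n (K : C) (M : 'M[C]_n) : Prop := forall v : 'rV_n, rvnorm (v *m M) <= K * rvnorm v.

Section Bounds.
Variable n : nat.
Implicit Types M : 'M[C]_n.

Lemma opbound_le (K K' : C) M : K <= K' -> opbound K M -> opbound K' M.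
Proof. by move=> KK MK v; rewrite (le_trans (MK v)) // ler_wpM2r ?rvnorm_ge0. Qed.

Lemma opboundM (K1 K2 : C) M1 M2 : 0 <= K2 -> opbound K1 M1 -> opbound K2 M2 -> opbound (K1 * K2) (M1 *m M2).
Proof.
move=> K0 M1K M2K v; rewrite mulmxA (le_trans (M2K _)) // mulrC [K1 * _]mulrC.
by rewrite mulrC -mulrA ler_wpM2l.
Qed.

Lemma opboundD K1 K2 M1 M2 : opbound K1 M1 -> opbound K2 M2 -> opbound (K1 + K2) (M1 + M2).
Proof.
by move=> M1K M2K v; rewrite mulmxDr (le_trans (rvnormD _ _)) // mulrDl lerD.
Qed.

Lemma opbound0 (K : C) : 0 <= K -> opbound K (0 : 'M[C]_n).
Proof. by move=> K0 v; rewrite mulmx0 rvnorm0 mulr_ge0 ?rvnorm_ge0. Qed.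

Lemma opboundZ a K M : opbound K M -> opbound (`|a| * K) (a *: M).
Proof. by move=> MK v; rewrite -scalemxAr rvnormZ -mulrA ler_wpM2l. Qed.

Lemma opboundN K M : opbound K M -> opbound K (- M).
Proof. by move=> MK; rewrite -scaleN1r -[K]mul1r -[X in X * K](@normrN1 C); apply: opboundZ. Qed.

Lemma opbound_sum (J : finType) (P : pred J) (K : J -> C) (M : J -> 'M[C]_n) :
  (forall j, P j -> opbound (K j) (M j)) -> opbound (\sum_(j | P j) K j) (\sum_(j | P j) M j).
Proof.
move=> MK; elim/big_rec2: _ => [|j A k Pj Ak]; first exact: opbound0.
by apply: opboundD => //; apply: MK.
Qed.

Lemma opbound_unitary M : M \is unitarymx -> opbound 1 M.
Proof.
move=> uM v; rewrite mul1r /rvnorm !dotmxE trmx_mul map_mxM mulmxA.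
by rewrite (mulmxtVK _ uM).
Qed.

Lemma opbound1 : opbound 1 (1%:M : 'M[C]_n).
Proof. by move=> v; rewrite mulmx1 mul1r. Qed.

Lemma opbound_tr K M : opbound K M -> `|\tr M| <= n%:R * K.
Proof.
move=> MK; apply: (le_trans (ler_norm_sum _ _ _)).
apply: (@le_trans _ _ (\sum_(i < n) K)).
  apply: ler_sum => i _; have := MK (delta_mx 0 i).
  rewrite rvnorm_delta mulr1 -rowE; apply: le_trans.
  by have := entry_le_rvnorm (row i M) i; rewrite mxE.
by rewrite sumr_const card_ord mulr_natl.
Qed.

Lemma opbound_diag (d : 'rV[C]_n) (K : C) : 0 <= K -> (forall i, `|d 0 i| <= K) -> opbound K (diag_mx d).
Proof.
move=> K0 dK v; rewrite -(ger0_norm K0) -rvnormZ /rvnorm ler_sqrtC ?nnegrE ?dnorm_ge0 //.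
rewrite !dotmx_self; apply: ler_sum => j _.
rewrite mul_mx_diag !mxE mulrC !normrM ler_pXn2r ?nnegrE ?mulr_ge0 //.
by rewrite (ger0_norm K0) ler_wpM2r.
Qed.

(** By the spectral theorem: in a unitary basis of eigenvectors the matrix is
    diagonal with entries at most K in absolute value. *)
Lemma opbound_hermitian (K : C) M : 0 <= K -> M ^t* = M ->
  (forall a (v : 'rV_n), v != 0 -> v *m M = a *: v -> `|a| <= K) -> opbound K M.
Proof.
move=> K0 hM eigM.
have /orthomx_spectralP eM : M \is normalmx by apply/normalmxP; rewrite hM.
set P := spectralmx M in eM; set D := spectral_diag M in eM.
have uP : P \is unitarymx by apply: spectral_unitarymx.
rewrite eM -[K]mul1r -[1]mulr1 -[1 * 1 * K]mulrA [1 * K]mulrC mulrA.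
apply: opboundM => //; last exact: opbound_unitary.
apply: opboundM => //.
  by apply: opbound_unitary; rewrite invmx_unitary // trmxC_unitary.
apply: opbound_diag => // i; apply: (eigM _ (row i P)).
  apply: contraTneq (spectral_unit M) => r0; rewrite unitmxE unitfE.
  rewrite -/P negbK; apply/eqP; rewrite (expand_det_row _ i) big1 // => j _.
  by move/rowP/(_ j): r0; rewrite !mxE => ->; rewrite mul0r.
rewrite [X in _ *m X]eM -row_mul !mulmxA mulmxV ?spectral_unit // mul1mx.
by rewrite row_mul row_diag_mx -scalemxAl -rowE.
Qed.

End Bounds.
End OperatorBounds.

(** * Eigenvalues of Jucys-Murphy elements on Specht modules *)

Lemma oP_mulg n (s t : 'S_n) : s \oP t = (t * s)%g. Proof. by []. Qed.

Lemma pcompA n (s t u : 'S_n) : s \oP (t \oP u) = (s \oP t) \oP u.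
Proof. by rewrite !oP_mulg mulgA. Qed.

Lemma pcomp_tpermK n (s : 'S_n) x y : (s \oP tperm x y) \oP tperm x y = s.
Proof. by rewrite !oP_mulg mulgA tperm2 mul1g. Qed.

Lemma tperm_oP n (s : 'S_n) x y : tperm (s x) (s y) \oP s = s \oP tperm x y.
Proof. by rewrite !oP_mulg [RHS]conjgC tpermJ. Qed.

Section JucysMurphyAt.
Variables (F : fieldType) (n : nat).

Definition jm_at (i : 'I_n) : galg F n := \sum_(k | k != i) gbase F (tperm i k).

Lemma gcoef_mul_base (f : galg F n) (t s : 'S_n) :
  gcoef (f * gbase F t) s = gcoef f (s \oP t^-1%g).
Proof.
rewrite gcoef_mul (bigD1 (s \oP t^-1%g)) //= gcoef_base !oP_mulg invMg invgK mulKVg.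
rewrite eqxx mulr1 big1 ?addr0 // => u us; rewrite gcoef_base; case: eqP => [e|_].
  by move: us; rewrite -e !oP_mulg invMg invgK mulgKV eqxx.
by rewrite mulr0.
Qed.

Lemma gcoef_base_mul (f : galg F n) (t s : 'S_n) :
  gcoef (gbase F t * f) s = gcoef f (t^-1%g \oP s).
Proof.
rewrite gcoef_mul (bigD1 t) //= gcoef_base eqxx mul1r big1 ?addr0 // => u /negPf ut.
by rewrite gcoef_base ut mul0r.
Qed.

(** Read s as a filling of the boxes by numbers: the number i sits in the box
    s^-1 i, and i is exchanged with the entry of each other box x. *)
Lemma gcoef_jm_at (f : galg F n) i s :
  gcoef (jm_at i * f) s =
  \sum_(x | x != s^-1%g i) gcoef f (s \oP tperm x (s^-1%g i)).
Proof.
rewrite /jm_at mulr_suml gcoef_sum (reindex_inj (@perm_inj _ s)) /=.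
apply: eq_big => [x|x _]; first by rewrite -(inj_eq (@perm_inj _ s) x) permKV.
rewrite gcoef_base_mul tpermV; congr (gcoef f _).
by rewrite !oP_mulg tpermC [RHS]conjgC tpermJ permKV.
Qed.

End JucysMurphyAt.

Section Specht.
Variables (F : numFieldType) (n : nat) (la : seq nat).
Hypothesis la_sum : sumn la = n.
Implicit Types (x y z : 'I_n) (s q : 'S_n) (j : nat).

Local Notation rowOf := (reshape_index la).
Local Notation colOf := (reshape_offset la).

Definition row_sum : galg F n := \sum_(p in row_stab n la) gbase F p.
Definition col_asum : galg F n := \sum_(q in col_stab n la) (-1) ^+ q *: gbase F q.

Lemma young_symmetrizerE : young_symmetrizer F n la = row_sum * col_asum.
Proof. by []. Qed.

Lemma row_sum_mul p : p \in row_stab n la -> row_sum * gbase F p = row_sum.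
Proof.
move=> pR; rewrite /row_sum mulr_suml.
rewrite [RHS](reindex_inj (mulgI p)) /=; apply: eq_big => [q|q _]; last by rewrite gbaseM.
rewrite !inE; apply/forallP/forallP => qR k; have := qR k.
  rewrite permM => /eqP; have := qR (p k) => /eqP-> _.
  by move: pR; rewrite inE => /forallP.
by have := qR (p^-1%g k); rewrite permM permKV => /eqP-> _; move: pR;
   rewrite inE => /forallP/(_ (p^-1%g k)); rewrite permKV eq_sym.
Qed.

Lemma col_stabM p q : p \in col_stab n la -> (p * q \in col_stab n la)%g = (q \in col_stab n la).
Proof.
move=> pR; rewrite !inE; apply/forallP/forallP => qR k.
  have := qR (p^-1%g k); rewrite permM permKV => /eqP->; move: pR.
  by rewrite inE => /forallP/(_ (p^-1%g k)); rewrite permKV eq_sym.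
rewrite permM; have /eqP-> := qR (p k).
by move: pR; rewrite inE => /forallP.
Qed.

Lemma tperm_col_stab x y : colOf x = colOf y -> tperm x y \in col_stab n la.
Proof. by move=> xy; rewrite inE; apply/forallP => k; case: tpermP => [->|->|]; rewrite ?xy. Qed.

Lemma tperm_row_stab x y : rowOf x = rowOf y -> tperm x y \in row_stab n la.
Proof. by move=> xy; rewrite inE; apply/forallP => k; case: tpermP => [->|->|]; rewrite ?xy. Qed.

Lemma col_asum_tperm x y : colOf x = colOf y -> x != y ->
  col_asum * gbase F (tperm x y) = - col_asum.
Proof.
move=> cxy xy; rewrite /col_asum mulr_suml.
rewrite [in RHS](reindex_inj (mulgI (tperm x y))) /= -sumrN.
apply: eq_big => [q|q _]; first by rewrite col_stabM // tperm_col_stab.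
rewrite -scalerAl gbaseM odd_permM odd_tperm xy /= signrN scaleNr opprK.
by [].
Qed.

(** Rows are initial segments: the row of z has a box in every column to the left
    of z. *)
Lemma box_exists z j : (j < colOf z)%N ->
  exists w : 'I_n, rowOf w = rowOf z /\ colOf w = j.
Proof.
move=> jz; have zn : (z < sumn la)%N by rewrite la_sum.
have jlt : (j < nth 0 la (rowOf z))%N by rewrite (ltn_trans jz) ?reshape_offsetP.
have wn : (flatten_index la (rowOf z) j < n)%N.
  by have := flatten_indexP jlt; rewrite la_sum.
by exists (Ordinal wn); rewrite /= flatten_indexKl // flatten_indexKr.
Qed.

Definition row_box z j : 'I_n :=
  odflt z [pick w : 'I_n | (rowOf w == rowOf z) && (colOf w == j)].

Lemma row_boxP z j : (j < colOf z)%N ->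
  rowOf (row_box z j) = rowOf z /\ colOf (row_box z j) = j.
Proof.
move=> jz; rewrite /row_box; case: pickP => [w /andP[/eqP ? /eqP ?] //|none].
by have [w [wr wc]] := box_exists jz; have := none w; rewrite wr wc !eqxx.
Qed.

Section Garnir.
Variables (y : 'I_n) (j : nat).
Hypothesis jy : (j < colOf y)%N.

(** The position that q sends to column j of the row of q y.  Swapping the images
    of y and of its partner is a row permutation. *)
Let partner q : 'I_n := q^-1%g (row_box (q y) j).

Let col_perm q x : q \in col_stab n la -> colOf (q x) = colOf x.
Proof. by rewrite inE => /forallP/(_ x)/eqP. Qed.

Let col_permV q x : q \in col_stab n la -> colOf (q^-1%g x) = colOf x.
Proof. by move=> qC; rewrite -(col_perm _ qC) permKV. Qed.

Let partner_row q : q \in col_stab n la -> rowOf (q (partner q)) = rowOf (q y).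
Proof.
by move=> qC; rewrite /partner permKV; apply: (row_boxP _).1; rewrite col_perm.
Qed.

Let partner_col q : q \in col_stab n la -> colOf (partner q) = j.
Proof.
by move=> qC; rewrite /partner col_permV //; apply: (row_boxP _).2; rewrite col_perm.
Qed.

Let swap_eq q x : q \in col_stab n la ->
  row_sum * gbase F (q \oP tperm x y) =
  row_sum * gbase F (tperm (q (partner q)) (q y) \oP (q \oP tperm x y)).
Proof.
move=> qC; have pR := tperm_row_stab (partner_row qC).
by rewrite -[in RHS]gbaseM mulrA [in RHS](row_sum_mul pR).
Qed.

Let partner_term q : q \in col_stab n la ->
  row_sum * gbase F (q \oP tperm (partner q) y) = row_sum * gbase F q.
Proof.
move=> qC; rewrite swap_eq //; congr (_ * gbase F _).
by rewrite pcompA tperm_oP pcomp_tpermK.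
Qed.

Let col_neq x : colOf x = j -> x != y.
Proof. by move=> xj; apply: contraTneq jy => <-; rewrite xj ltnn. Qed.

Let term q x : galg F n := (-1) ^+ q *: (row_sum * gbase F (q \oP tperm x y)).
(** The sign-reversing involution on the terms that [garnir] has to cancel. *)
Let flip (p : 'S_n * 'I_n) : 'S_n * 'I_n :=
  (p.1 \oP tperm p.2 (partner p.1), partner p.1).
Let admissible (p : 'S_n * 'I_n) : bool :=
  [&& p.1 \in col_stab n la, colOf p.2 == j & p.2 != partner p.1].

Let partner_flip p : admissible p -> partner (flip p).1 = p.2.
Proof.
case: p => q x /and3P[/= qC /eqP xj xp].
rewrite /partner /flip /= pcompE tpermD ?col_neq ?partner_col //.
by rewrite !oP_mulg invMg tpermV permM -/(partner q) tpermR.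
Qed.

Let flipK p : admissible p -> flip (flip p) = p.
Proof.
move=> adm; rewrite [LHS]/flip partner_flip //; case: p adm => q x adm /=.
by rewrite (tpermC _ x) pcomp_tpermK.
Qed.

Let flip_admissible p : admissible p -> admissible (flip p).
Proof.
move=> adm; apply/and3P; rewrite partner_flip //; case: p adm => q x.
case/and3P=> [/= qC /eqP xj xp]; split; last by rewrite eq_sym.
  by rewrite col_stabM // tperm_col_stab // partner_col.
by rewrite partner_col.
Qed.

Let term_flip p : admissible p -> term (flip p).1 (flip p).2 = - term p.1 p.2.
Proof.
case: p => q x adm; have [/= qC /eqP xj xp] := and3P adm.
rewrite /term /flip /= odd_permM odd_tperm xp signrN scaleNr; congr (- (_ *: _)).
rewrite [RHS]swap_eq //; congr (_ * gbase F _).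
have xy := col_neq xj; have py := col_neq (partner_col qC).
rewrite pcompA tperm_oP -!pcompA; congr (_ \oP _).
by rewrite !oP_mulg [RHS]conjgC tpermJ tpermR tpermD // eq_sym.
Qed.

(** The relation of the Specht module between column j and a box y to its right,
    for one box at a time.  Expand the column antisymmetrizer in the right-hand
    side over pairs (q, x).  The pairs where x is the partner of q give the
    left-hand side, since the row symmetrizer absorbs the transposition of the
    images of x and y.  The same absorption pairs off all other terms, with
    opposite signs. *)
Lemma garnir : row_sum * col_asum =
  \sum_(x : 'I_n | colOf x == j) row_sum * col_asum * gbase F (tperm x y).
Proof.
have expand x : row_sum * col_asum * gbase F (tperm x y) =
    \sum_(q in col_stab n la) term q x.
  rewrite /col_asum mulr_sumr mulr_suml; apply: eq_bigr => q _.
  by rewrite -scalerAr -scalerAl -mulrA gbaseM.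
under eq_bigr do rewrite expand.
rewrite exchange_big /=.
have split_partner q : q \in col_stab n la ->
    \sum_(x : 'I_n | colOf x == j) term q x =
    (-1) ^+ q *: (row_sum * gbase F q) + \sum_(x : 'I_n | (colOf x == j) && (x != partner q)) term q x.
  move=> qC; rewrite (bigD1 (partner q)) ?partner_col //=.
  by rewrite /term partner_term.
rewrite (eq_bigr _ split_partner) big_split /=.
rewrite -[LHS]addr0; congr (_ + _).
  by rewrite mulr_sumr; apply: eq_bigr => q _; rewrite -scalerAr.
rewrite pair_big_dep (eq_bigl admissible) //=.
set S := \sum_(p | _) _; have : S = - S.
  rewrite {1}/S (reindex_onto flip flip); last by move=> p /flipK.
  rewrite -sumrN; apply: eq_big => [p|p].
    apply/andP/idP => [[adm /eqP e]|adm]; last by rewrite flip_admissible // flipK.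
    by have := flip_admissible adm; rewrite e.
  move=> /andP[adm /eqP e]; apply: term_flip.
  by have := flip_admissible adm; rewrite e.
move/eqP; rewrite -addr_eq0 -mulr2n -scaler_nat scaler_eq0 pnatr_eq0 /=.
by move/eqP.
Qed.

End Garnir.

(** The eigenvalue is the content of the box at the foot of the column of y: the
    column number minus the number of other boxes in this column.  Among the
    fillings s in the support of f choose one where the box y of the number i is as
    far to the right as possible, and compare coefficients at s.  Exchanging i with
    an entry further right gives 0 by this choice, exchanging it with another entry
    of the same column gives - f s, and by [garnir] the exchanges with the entries
    of one column to the left add up to f s. *)
Lemma specht_eigenvalue (z : galg F n) (i : 'I_n) (a : F) :
  let f := z * young_symmetrizer F n la in
  f != 0 -> jm_at F i * f = a *: f ->
  exists y : 'I_n, a = (colOf y)%:R - #|[pred x : 'I_n | (colOf x == colOf y) && (x != y)]|%:R.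
Proof.
move=> f f0 eig.
have anti x y s : colOf x = colOf y -> x != y -> gcoef f (s \oP tperm x y) = - gcoef f s.
  move=> cxy xy; rewrite -[tperm x y]tpermV -gcoef_mul_base /f young_symmetrizerE -!mulrA.
  by rewrite col_asum_tperm // !mulrN -scaleN1r gcoefZ mulN1r.
have gar y j s : (j < colOf y)%N ->
    gcoef f s = \sum_(x : 'I_n | colOf x == j) gcoef f (s \oP tperm x y).
  move=> jy; rewrite {1}/f young_symmetrizerE (garnir jy) mulr_sumr gcoef_sum.
  by apply: eq_bigr => x _; rewrite mulrA -young_symmetrizerE -/f gcoef_mul_base tpermV.
have [s0 fs0] : exists s, gcoef f s != 0.
  apply/existsP; apply: contraNT f0; rewrite negb_exists => /forallP fs.
  by apply/eqP/galgP => s; have := fs s; rewrite negbK gcoef0 => /eqP.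
pose P s := gcoef f s != 0.
case: (@arg_maxnP _ s0 P (fun s => colOf (s^-1%g i)) fs0) => s fs smax.
set y := s^-1%g i in smax; exists y.
apply: (mulIf fs); rewrite -gcoefZ -eig gcoef_jm_at -/y.
rewrite (bigID (fun x => colOf x == colOf y)) /= addrC mulrBl; congr (_ + _).
  rewrite (bigID (fun x => colOf x < colOf y)%N) /= [X in _ + X]big1 ?addr0; last first.
    move=> x /andP[/andP[xy cxy]]; rewrite -leqNgt => lt_yx.
    apply/eqP; apply: contraTT lt_yx => fx; rewrite -ltnNge ltn_neqAle cxy.
    have := smax _ fx; rewrite oP_mulg invMg permM tpermV -/y tpermR; exact.
  transitivity (\sum_(j < colOf y) gcoef f s); last first.
    by rewrite sumr_const card_ord mulr_natl.
  under [RHS]eq_bigr => j _ do rewrite (gar y j s (ltn_ord j)).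
  rewrite (exchange_big_dep (fun x => colOf x < colOf y)%N) /=; last first.
    by move=> j x _ /eqP->.
  apply: eq_big => [x|x].
    by case: (ltngtP (colOf x) (colOf y)); rewrite ?andbF ?andbT //; case: eqP => // ->; rewrite ltnn.
  move=> /andP[_ lt_xy]; rewrite (big_pred1 (Ordinal lt_xy)) //.
rewrite (eq_bigr (fun=> - gcoef f s)) => [|x /andP[xy /eqP cxy]]; last exact: anti.
rewrite sumr_const mulNrn mulr_natl; congr (- (_ *+ _)).
by apply: eq_card => x; rewrite !inE andbC.
Qed.

Lemma column_card y : (#|[pred x : 'I_n | (colOf x == colOf y) && (x != y)]| < size la)%N.
Proof.
set A := [pred x : 'I_n | _].
have -> : #|A|.+1 = #|[pred x : 'I_n | colOf x == colOf y]|.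
  by rewrite [RHS](cardD1 y) !inE eqxx add1n; congr _.+1; apply: eq_card => x; rewrite !inE andbC.
have lt_row x : (rowOf x < size la)%N by apply: reshape_indexP; rewrite la_sum.
rewrite -[size la]card_ord.
rewrite -(card_in_imset (f := fun x => Ordinal (lt_row x))); first exact: max_card.
move=> x x'; rewrite !inE => /eqP cx /eqP cx' [rx]; apply: val_inj => /=.
by rewrite -(reshape_indexK la x) -(reshape_indexK la x') cx cx' rx.
Qed.

Lemma col_lt_row y : (colOf y < nth 0 la (rowOf y))%N.
Proof. by apply: reshape_offsetP; rewrite la_sum. Qed.

End Specht.

(** * A unitary form of the representation *)

Section GalgRow.
Variables (F : fieldType) (n : nat).
Local Notation G := [set: 'S_n]%G.

Lemma galg_row_coef (f : galg F n) s : galg_row f 0 (gring_index G s) = gcoef f s.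
Proof.
rewrite /galg_row summxE (bigD1 s) //= !mxE !eqxx mulr1 big1 ?addr0 // => t ts.
rewrite !mxE eqxx /=; case: eqP => [e|_]; last by rewrite mulr0.
have := congr1 enum_val e; rewrite !gring_indexK ?inE // => st.
by rewrite st eqxx in ts.
Qed.

Lemma galg_row_is_linear : linear (@galg_row F n).
Proof.
move=> a f g; rewrite /galg_row scaler_sumr -big_split /=; apply: eq_bigr => s _.
by rewrite gcoefD gcoefZ scalerDl scalerA.
Qed.

HB.instance Definition _ := GRing.isLinear.Build F (galg F n) _ _ (@galg_row F n) galg_row_is_linear.

Lemma galg_row_inj (f g : galg F n) : galg_row f = galg_row g -> f = g.
Proof.
by move=> e; apply: galgP => s; rewrite -!galg_row_coef e.
Qed.

Lemma galg_row_base s : galg_row (gbase F s) = delta_mx 0 (gring_index G s).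
Proof.
rewrite /galg_row (bigD1 s) //= gcoef_base eqxx scale1r big1 ?addr0 // => t /negPf ts.
by rewrite gcoef_base ts scale0r.
Qed.

Lemma galg_row_regular (f : galg F n) s :
  galg_row f *m regular_repr F G s = galg_row (gbase F s * f).
Proof.
rewrite [in LHS](galg_sum f) [in RHS](galg_sum f) mulr_sumr !linear_sum /= mulmx_suml.
apply: eq_bigr => t _; rewrite -scalerAr !linearZ /= -scalemxAl; congr (_ *: _).
by rewrite gbaseM !galg_row_base -rowE rowK gring_indexK ?inE.
Qed.

(** The cyclic module of c in the regular representation is the left ideal
    generated by c. *)
Lemma cyclic_galg_row (c : galg F n) (w : 'rV_#|G|) :
  (w <= cyclic_mx (regular_repr F G) (galg_row c))%MS ->
  exists z, w = galg_row (z * c).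
Proof.
case/cyclic_mxP => A /envelop_mxP[a ->] ->.
exists (\sum_s a s *: gbase F s); rewrite mulr_suml mulmx_sumr linear_sum /=.
apply: eq_big => [s|s _]; first by rewrite inE.
by rewrite -scalerAl -scalemxAr galg_row_regular linearZ.
Qed.

Lemma regular_tr s : (regular_repr F G s)^T = regular_repr F G s^-1%g.
Proof.
apply/matrixP => i j; rewrite !mxE !eqxx /=; congr (nat_of_bool _)%:R.
apply/eqP/eqP => ->.
  by rewrite gring_indexK ?inE // mulgK gring_valK.
by rewrite gring_indexK ?inE // mulgKV gring_valK.
Qed.

End GalgRow.

Section UnitaryModel.
Local Open Scope sesquilinear_scope.
Variables (C : numClosedFieldType) (n d : nat) (la : seq nat).
Local Notation G := [set: 'S_n]%G.
Variable rho : mx_representation C G d.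

(** What the rest of the proof uses about the representation: in a suitable basis
    it is a family u of contractions with the same traces, Schur's lemma holds, and
    the Jucys-Murphy elements are bounded by K.  Like rho, u is multiplicative for
    the product of permutations from left to right. *)
Record unitary_model (K : C) (u : 'S_n -> 'M[C]_d) : Prop := UnitaryModel {
  um_dim : (0 < d)%N;
  um1 : u 1%g = 1%:M;
  umM : forall s t, u (s * t)%g = u s *m u t;
  um_opbound : forall s, opbound 1 (u s);
  um_tr : forall s, \tr (rho s) = \tr (u s);
  um_schur : forall M, (forall s, u s *m M = M *m u s) -> exists a, M = a%:M;
  um_jm : forall i, opbound K (\sum_(k | k != i) u (tperm i k))
}.

Lemma regular_ct s : (regular_repr C G s) ^t* = regular_repr C G s^-1%g.
Proof.
rewrite regular_tr; apply/matrixP => i j; rewrite !mxE.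
by case: (_ && _); rewrite ?rmorph1 ?rmorph0.
Qed.

(** The regular representation acts by permutation matrices, hence unitarily, so
    an orthonormal basis of the Specht module inside it makes the representation
    unitary.  The Jucys-Murphy elements become Hermitian, being sums of
    involutions, and their eigenvalues are contents of boxes, which are bounded by
    the lengths of the rows and columns. *)
Lemma unitary_model_exists (K : C) :
  young_diagram n la -> irrep_of_shape la rho ->
  (forall i, (nth 0%N la i)%:R <= K) -> (size la)%:R <= K ->
  exists u, unitary_model K u.
Proof.
move=> /and3P[_ _ /eqP la_sum] [irr [B dU Bfree Bhom]] rowK colK.
have K0 : 0 <= K by apply: le_trans colK; rewrite ler0n.
pose reg := regular_repr C G.
pose cyc := cyclic_mx_module reg (galg_row (young_symmetrizer C n la)).
pose E := B *m val_submod 1%:M.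
have Ehom s : rho s *m E = E *m reg s.
  rewrite /E mulmxA Bhom ?inE // -[LHS]mulmxA -[RHS]mulmxA; congr (_ *m _).
  have := val_submodJ cyc 1%:M (finset.in_setT s); rewrite mul1mx [LHS]val_submodE; exact.
have Efree : row_free E.
  rewrite /E /row_free mxrankMfree //.
  by rewrite /row_free val_submod1.
have Esub : (E <= cyclic_mx reg (galg_row (young_symmetrizer C n la)))%MS.
  by rewrite /E mulmx_sub // val_submodP.
(* the rows of S are an orthonormal basis of the Specht module *)
pose S := schmidt E.
have dN : (d <= #|G|)%N by rewrite -(eqP Efree) rank_leq_col.
have Su : S *m S^t* = 1%:M by apply/unitarymxP/schmidt_unitarymx.
have ES := eqmx_schmidt_free Efree.
have [D ED] : exists D, E = D *m S by apply/submxP; rewrite ES.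
have [D' SD] : exists D', S = D' *m E by apply/submxP; rewrite -ES.
have DD : D' *m D = 1%:M.
  by rewrite -[LHS]mulmx1 -Su mulmxA -(mulmxA D') -ED -SD.
pose u s := D' *m rho s *m D.
have D'D := mulmx1C DD.
have uS s : u s *m S = S *m reg s.
  by rewrite /u -mulmxA -ED -mulmxA Ehom mulmxA -SD.
have uE s : u s = S *m reg s *m S^t*.
  by rewrite -uS -mulmxA Su mulmx1.
have uct s : (u s)^t* = u s^-1%g.
  by rewrite !uE !trmx_mul !map_mxM trmxCK regular_ct mulmxA.
have u1 : u 1%g = 1%:M by rewrite /u repr_mx1 mulmx1.
have uM s t : u (s * t)%g = u s *m u t.
  rewrite /u repr_mxM ?inE // !mulmxA; congr (_ *m _ *m _).
  by rewrite -(mulmxA _ D) D'D mulmx1.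
have rhoE s : rho s = D *m u s *m D'.
  by rewrite /u !mulmxA D'D mul1mx -mulmxA D'D mulmx1.
have utr s : \tr (rho s) = \tr (u s) by rewrite rhoE mxtrace_mulC mulmxA DD mul1mx.
clearbody u.
exists u; split => //.
- by case/mx_irrP: irr.
- move=> s; apply: opbound_unitary; apply/unitarymxP.
  by rewrite uct -uM mulgV u1.
- move=> M Mcomm.
  have d0 : (0 < d)%N by case/mx_irrP: irr.
  pose N := D *m M *m D'.
  have Ncomm : centgmx rho N.
    apply/centgmxP => s _.
    rewrite rhoE /N !mulmxA -(mulmxA _ D' D) DD mulmx1 -(mulmxA _ D' D) DD mulmx1.
    by rewrite -(mulmxA D M) -Mcomm mulmxA.
  have [a /eigenvalueP[v vN v0]] := eigenvalue_closed N d0.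
  exists a; suff NE : N = a%:M.
    rewrite -[M]mul1mx -DD -[LHS]mulmx1 -DD !mulmxA -(mulmxA D') -(mulmxA _ _ D').
    by rewrite -/N NE mul_mx_scalar -scalemxAl DD scalemx1.
  apply/eqP; rewrite -subr_eq0; apply: contraT => Na0.
  have cent : centgmx rho (N - a%:M).
    apply/centgmxP => s _; move/centgmxP/(_ s): Ncomm; rewrite inE => /(_ isT) e.
    by rewrite mulmxBl mulmxBr e scalar_mxC.
  have Nu := mx_Schur irr cent Na0.
  move: v0; rewrite -[v](mulmxK Nu) mulmxBr vN mul_mx_scalar subrr mul0mx eqxx //.
- move=> i; apply: opbound_hermitian => //.
    rewrite linear_sum raddf_sum /=; apply: eq_bigr => k _; rewrite uct.
    by rewrite tpermV.
  move=> a v v0 eig.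
  have regJ (f : galg C n) : galg_row f *m (\sum_(k | k != i) reg (tperm i k)) = galg_row (jm_at C i * f).
    rewrite /jm_at mulr_suml mulmx_sumr linear_sum /=; apply: eq_bigr => k _.
    exact: galg_row_regular.
  have [z wz] : exists z, v *m S = galg_row (z * young_symmetrizer C n la).
    apply: cyclic_galg_row; apply: submx_trans Esub.
    by rewrite mulmx_sub // ES.
  have [||y ay] := @specht_eigenvalue C n la la_sum z i a.
  - apply: contra v0 => /eqP e; rewrite e linear0 in wz.
    by rewrite -[v]mulmx1 -Su mulmxA wz mul0mx.
  - apply: galg_row_inj; rewrite -regJ -wz linearZ /= -wz scalemxAl -eig -!mulmxA.
    congr (_ *m _); rewrite mulmx_suml mulmx_sumr; apply: eq_bigr => k _.
    by rewrite uS.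
  have len := column_card la_sum y; move: ay; set len' := #|_| in len * => ->.
  have real_a : (reshape_offset la y)%:R - len'%:R \is @Num.real C by rewrite rpredB // realn.
  rewrite real_ler_norml //; apply/andP; split.
    rewrite lerNl opprB lerBlDr (le_trans (y := K)) ?lerDl //.
    by rewrite (le_trans _ colK) // ler_nat ltnW.
  rewrite lerBlDr (le_trans (y := K)) ?lerDl //.
  by rewrite (le_trans _ (rowK (reshape_index la y))) // ler_nat ltnW // col_lt_row.
Qed.

End UnitaryModel.

(** * Operators as matrices of blocks *)

Section Blocks.
Variables (C : numClosedFieldType) (n d : nat).
Variables (rho : mx_representation C [set: 'S_n]%G d) (K : C) (u : 'S_n -> 'M[C]_d).
Hypothesis um : unitary_model rho K u.

Local Notation opalg := (opalg C n).

Definition block (i j : 'I_n.+1) (T : opalg) : 'M[C]_d := lin_ext u (entry T i j).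

Lemma entry_is_linear i j : linear (fun T : opalg => entry T i j).
Proof.
by move=> a T S; rewrite /entry lfunE /= lfunE /= componentD componentZ.
Qed.

Lemma block_is_linear i j : linear (block i j).
Proof. by move=> a T S; rewrite /block entry_is_linear linearP. Qed.

HB.instance Definition _ i j := GRing.isLinear.Build C opalg 'M[C]_d _ (block i j) (block_is_linear i j).

(** u is multiplicative from left to right, the group algebra uses composition:
    products are reversed.  The entries of a composite of operators are reversed as
    well, so that [blockM] is the usual product of matrices. *)
Lemma lin_extM (x y : galg C n) : lin_ext u (x * y) = lin_ext u y *m lin_ext u x.
Proof.
rewrite [in LHS](galg_sum x) mulr_suml linear_sum /= [lin_ext u x]/lin_ext mulmx_sumr.
apply: eq_bigr => s _; rewrite -scalerAl linearZ /= -scalemxAr; congr (_ *: _).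
rewrite [in LHS](galg_sum y) mulr_sumr linear_sum /= [lin_ext u y]/lin_ext mulmx_suml.
apply: eq_bigr => t _; rewrite -scalerAr linearZ /= -scalemxAl; congr (_ *: _).
by rewrite gbaseM lin_ext_base oP_mulg (umM um).
Qed.

Lemma lin_ext1 : lin_ext u (1 : galg C n) = 1%:M.
Proof. by rewrite -gbase1 lin_ext_base (um1 um). Qed.

Lemma blockM T S i j : block i j (T * S) = \sum_k block i k T *m block k j S.
Proof.
rewrite /block; have TS : has_entries (T * S : opalg)
    (\matrix_(i, j) \sum_k entry S k j * entry T i k).
  move=> x l; rewrite opalgME (entryP S) linear_sum /=.
  under eq_bigr do rewrite (entryP T); rewrite exchange_big /=; apply: eq_bigr => m _.
  rewrite mxE mulr_sumr linear_sum mulr_suml /=.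
  by apply: eq_bigr => k _; rewrite !mxE mulrA.
rewrite (has_entriesE TS) mxE linear_sum /=.
by apply: eq_bigr => k _; rewrite lin_extM.
Qed.

Lemma block1 i j : block i j 1 = (i == j)%:R%:M.
Proof.
rewrite /block /entry lfunE /= -[gbase C _]mul1r -emb1 component_coset.
by case: eqP; rewrite ?lin_ext1 // linear0 raddf0.
Qed.

Lemma phi_block T : phi rho T = n.+1%:R^-1 * \sum_i \tr (block i i T) / d%:R.
Proof.
congr (_ * _); apply: eq_bigr => i _; congr (_ / _).
rewrite /block /lin_ext linear_sum /=; apply: eq_bigr => s _.
by rewrite linearZ /= (um_tr um).
Qed.

Lemma blockX i j : block i j (Xop C n) =
  if i == j then 0 else
    match unlift ord0 i, unlift ord0 j with
    | Some a, Some b => u (tperm a b)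
    | _, _ => 1%:M
    end.
Proof.
rewrite /block (has_entriesE (@X_entries C n)) mxE; case: eqP => _; first exact: linear0.
by case: (unlift ord0 i) => [a|]; case: (unlift ord0 j) => [b|];
  rewrite ?lin_ext1 // lin_ext_base.
Qed.

Lemma blockP k i j : block i j (Pop C n k) = ((i == j) && (i <= k)%N)%:R%:M.
Proof.
rewrite /block (has_entriesE (@P_entries C n k)) mxE; case: ifP => _.
  exact: lin_ext1.
by rewrite linear0 raddf0.
Qed.

Lemma model_tpermK a b : u (tperm a b) *m u (tperm a b) = 1%:M.
Proof. by rewrite -(umM um) tperm2 (um1 um). Qed.

Local Notation pt := (lift (@ord0 n)).

(** Conjugation by a transposition of S_n permutes the indices other than 0. *)
Definition covariant T : Prop := forall (a b : 'I_n) i j,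
  block (tperm (pt a) (pt b) i) (tperm (pt a) (pt b) j) T =
  u (tperm a b) *m block i j T *m u (tperm a b).

Lemma covariant1 : covariant 1.
Proof.
move=> a b i j; rewrite !block1 (inj_eq perm_inj) mul_mx_scalar -scalemxAl model_tpermK.
by rewrite scalemx1.
Qed.

Lemma covariantD T S : covariant T -> covariant S -> covariant (T + S).
Proof. by move=> cT cS a b i j; rewrite [in LHS]linearD [block i j _]linearD /= cT cS mulmxDr mulmxDl. Qed.

Lemma covariantZ c T : covariant T -> covariant (c *: T).
Proof. by move=> cT a b i j; rewrite [in LHS]linearZ [block i j _]linearZ /= cT -scalemxAr -scalemxAl. Qed.

Lemma covariantM T S : covariant T -> covariant S -> covariant (T * S).
Proof.
move=> cT cS a b i j; rewrite !blockM mulmx_sumr mulmx_suml.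
rewrite (reindex_inj (@perm_inj _ (tperm (pt a) (pt b)))) /=; apply: eq_bigr => k _.
rewrite cT cS !mulmxA; congr (_ *m _ *m _).
by rewrite -mulmxA model_tpermK mulmx1.
Qed.

Lemma tperm_pt0 a b : tperm (pt a) (pt b) ord0 = ord0.
Proof. by rewrite tpermD. Qed.

Lemma tperm_pt a b c : tperm (pt a) (pt b) (pt c) = pt (tperm a b c).
Proof. by rewrite -(inj_tperm _ _ _ (@lift_inj _ ord0)). Qed.

Lemma covariantX : covariant (Xop C n).
Proof.
move=> a b i j; rewrite !blockX (inj_eq perm_inj); case: eqP => [_|ij].
  by rewrite mulmx0 mul0mx.
case: (unliftP ord0 i) => [i'|] ->; rewrite ?tperm_pt ?tperm_pt0 ?liftK ?unlift_none; last first.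
  by rewrite mulmx1 model_tpermK.
case: (unliftP ord0 j) => [j'|] ->; rewrite ?tperm_pt ?tperm_pt0 ?liftK ?unlift_none; last first.
  by rewrite mulmx1 model_tpermK.
rewrite -!(umM um) -[in RHS](tpermV a b) -tpermJ conjgE mulgA tpermV.
by [].
Qed.

Lemma covariantXn T p : covariant T -> covariant (T ^+ p).
Proof.
by move=> cT; elim: p => [|p IH]; [exact: covariant1|rewrite exprS; apply: covariantM].
Qed.

Lemma Xop_exp p f : (Xop C n ^+ p : opalg) f = jucys_murphy C n ^+ p * f.
Proof.
elim: p f => [|p IH] f; first by rewrite lfunE mul1r.
by rewrite exprS opalgME IH lfunE /= exprS mulrA.
Qed.

(** Left multiplication commutes with right multiplication by tau_j, so that the
    j-th diagonal entry is the component of J^p tau_j at tau_j, which is that of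
    J^p at the identity coset. *)
Lemma Xop_exp_diag p j : block j j (Xop C n ^+ p) = block ord0 ord0 (Xop C n ^+ p).
Proof.
rewrite /block; congr (lin_ext u _); rewrite /entry !Xop_exp; apply: galgP => s.
rewrite !componentE !gcoef_mul_base; congr gcoef.
have tau2 i : (emb_perm s \oP tau i) \oP (tau i)^-1%g = emb_perm s :> 'S_n.+1.
  by rewrite !oP_mulg mulKg.
by rewrite !tau2.
Qed.

(** The index 0 is fixed by S_n, so this block commutes with all u s, and Schur's
    lemma applies. *)
Lemma covariant_scalar T : covariant T -> exists m, block ord0 ord0 T = m%:M.
Proof.
move=> cT; apply: (um_schur um) => s.
case/prod_tpermP: (s) => ts -> _.
elim: ts => [|t ts IH]; first by rewrite big_nil (um1 um) mul1mx mulmx1.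
rewrite big_cons (umM um) -mulmxA IH !mulmxA; congr (_ *m _).
have := cT t.1 t.2 ord0 ord0; rewrite tperm_pt0 => e.
by rewrite {1}e !mulmxA model_tpermK mul1mx.
Qed.

End Blocks.

(** * Bounds for the blocks of powers of X *)

Section EntryBounds.
Variables (C : numClosedFieldType) (n d : nat).
Variables (rho : mx_representation C [set: 'S_n]%G d) (K : C) (u : 'S_n -> 'M[C]_d).
Hypothesis um : unitary_model rho K u.
Local Notation opalg := (opalg C n).
Local Notation pt := (lift (@ord0 n)).
Local Notation X := (Xop C n).
Local Notation block i j T := (block u i j T).

Lemma block_transport T (a b : 'I_n) j : covariant u T -> j != pt a -> j != pt b ->
  u (tperm a b) *m block (pt b) j T = block (pt a) j T *m u (tperm a b).
Proof.
move=> cT ja jb; have := cT a b (pt a) j; rewrite tpermL tpermD 1?eq_sym // => ->.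
by rewrite !mulmxA (model_tpermK um) mul1mx.
Qed.

Lemma blockX0 a : block ord0 (pt a) X = 1%:M.
Proof. by rewrite (blockX um) (negPf (neq_lift _ _)) unlift_none. Qed.

Lemma blockX_0 a : block (pt a) ord0 X = 1%:M.
Proof. by rewrite (blockX um) eq_sym (negPf (neq_lift _ _)) liftK unlift_none. Qed.

Lemma blockXX a b : b != a -> block (pt a) (pt b) X = u (tperm a b).
Proof. by move=> ba; rewrite (blockX um) (inj_eq lift_inj) eq_sym (negPf ba) !liftK. Qed.

Lemma blockXd i : block i i X = 0.
Proof. by rewrite (blockX um) eqxx. Qed.

Definition jm_block a : 'M[C]_d := \sum_(b | b != a) u (tperm a b).

(** In the sum over the intermediate index b, covariance moves the transposition
    (a b) to the right of a block that does not depend on b; what remains to be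
    summed is a Jucys-Murphy element without one of its terms. *)
Lemma block_rec_pt_pt T a c : covariant u T -> c != a ->
  block (pt a) (pt c) (X * T) =
  block ord0 (pt c) T + u (tperm a c) *m block (pt c) (pt c) T
  + block (pt a) (pt c) T *m (jm_block a - u (tperm a c)).
Proof.
move=> cT ca; rewrite (blockM um) big_ord_recl /= blockX_0 mul1mx -addrA; congr (_ + _).
rewrite (bigD1 a) //= blockXd mul0mx add0r (bigD1 c) //= blockXX //; congr (_ + _).
have -> : jm_block a - u (tperm a c) = \sum_(b | (b != a) && (b != c)) u (tperm a b).
  by rewrite /jm_block (bigD1 c) //= addrAC subrr add0r.
rewrite mulmx_sumr; apply: eq_bigr => b /andP[ba bc].
by rewrite blockXX // block_transport // (inj_eq lift_inj) eq_sym // eq_sym.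
Qed.

Lemma block_rec_pt0 T a : covariant u T ->
  block (pt a) ord0 (X * T) = block ord0 ord0 T + block (pt a) ord0 T *m jm_block a.
Proof.
move=> cT; rewrite (blockM um) big_ord_recl /= blockX_0 mul1mx; congr (_ + _).
rewrite (bigD1 a) //= blockXd mul0mx add0r mulmx_sumr; apply: eq_bigr => b ba.
by rewrite blockXX // block_transport // neq_lift.
Qed.

(** For row 0 the blocks of X are identities and nothing can be moved; the last
    factor X of the product is split off instead of the first one. *)
Lemma block_rec_0pt T c : covariant u T ->
  block ord0 (pt c) (T * X) = block ord0 ord0 T + jm_block c *m block ord0 (pt c) T.
Proof.
move=> cT; rewrite (blockM um) big_ord_recl /= blockX0 mulmx1; congr (_ + _).
rewrite (bigD1 c) //= blockXd mulmx0 add0r mulmx_suml; apply: eq_bigr => b bc.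
rewrite blockXX 1?eq_sym // (tpermC b c).
have := cT c b ord0 (pt c); rewrite tpermL tperm_pt0 => ->.
by rewrite -mulmxA (model_tpermK um) mulmx1.
Qed.

Lemma block_rec_00 T : block ord0 ord0 (X * T) = \sum_a block (pt a) ord0 T.
Proof.
rewrite (blockM um) big_ord_recl /= blockXd mul0mx add0r.
by apply: eq_bigr => a _; rewrite blockX0 mul1mx.
Qed.

Variables (r c : C).
Hypotheses (r1 : 1 <= r) (rn : r ^+ 2 = n%:R) (c1 : 1 <= c) (K0 : 0 <= K).
Hypothesis rKc : r + K + 2 <= c * r.

Let r0 : 0 < r. Proof. exact: lt_le_trans r1. Qed.
Let c0 : 0 <= c. Proof. exact: le_trans c1. Qed.
Let rV0 : 0 <= r^-1. Proof. by rewrite invr_ge0 ltW. Qed.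
Let jm_block_opbound a : opbound K (jm_block a). Proof. exact: um_jm um a. Qed.

Local Notation x := (r^-1 *: X).

Lemma covariant_x p : covariant u (x ^+ p).
Proof. by apply: (covariantXn um); apply: covariantZ; apply: covariantX um. Qed.

Lemma x_diag p j : block j j (x ^+ p) = block ord0 ord0 (x ^+ p).
Proof. by rewrite exprZn !linearZ /= (Xop_exp_diag u p j). Qed.

(** Bounds for diagonal and other blocks are proved together.  The recursions
    express a block of x ^+ p.+1 off the diagonal as r^-1 times at most one diagonal
    block and some blocks off the diagonal, one of them multiplied by an operator of
    norm at most K + 1; the hypothesis on c makes c the growth factor.  The diagonal blocks
    are all equal to r^-1 times the sum of the n = r ^+ 2 other blocks in column 0
    of x ^+ p, each of size c ^+ p / r. *)
Lemma x_bounds p :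
  (forall i, opbound (c ^+ p) (block i i (x ^+ p))) /\
  (forall i j, i != j -> opbound (c ^+ p / r) (block i j (x ^+ p))).
Proof.
elim: p => [|p [IHd IHo]].
  split=> [i|i j /negPf ij]; rewrite (block1 um) ?eqxx ?ij expr0.
    exact: opbound1.
  by rewrite raddf0; apply: opbound0; rewrite mul1r.
have cp0 : 0 <= c ^+ p by rewrite exprn_ge0.
have nV0 : `|r^-1| = r^-1 by rewrite ger0_norm.
have covp := covariant_x p.
have step : r^-1 * (c ^+ p / r + c ^+ p + c ^+ p / r * (K + 1)) <= c ^+ p.+1 / r.
  have -> : c ^+ p / r + c ^+ p + c ^+ p / r * (K + 1) = c ^+ p * ((r + K + 2) / r).
    by field; rewrite gt_eqF.
  rewrite mulrC ler_wpM2r // exprSr ler_wpM2l // ler_pdivrMr //.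
have step0 : r^-1 * (c ^+ p + c ^+ p / r * K) <= c ^+ p.+1 / r.
  apply: le_trans step; rewrite ler_wpM2l // -addrA [X in _ <= X]addrC -addrA lerD2l.
  rewrite ler_wpDr ?divr_ge0 ?(ltW r0) // ler_wpM2l ?divr_ge0 ?(ltW r0) //.
  by rewrite lerDl.
split=> [i|i j ij].
  rewrite x_diag (exprS x) -scalerAl linearZ /= block_rec_00.
  apply: (@opbound_le _ _ (`|r^-1| * \sum_(a < n) (c ^+ p / r))).
    rewrite nV0 sumr_const card_ord -mulr_natl -rn (exprSr c p).
    have -> : r^-1 * (r ^+ 2 * (c ^+ p / r)) = c ^+ p by field; rewrite gt_eqF.
    by rewrite ler_peMr.
  by apply/opboundZ/opbound_sum => a _; apply: IHo; rewrite eq_sym neq_lift.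
case: (unliftP ord0 i) ij => [a|] -> ; last first.
  case: (unliftP ord0 j) => [b|] -> // _.
  rewrite (exprSr x) -scalerAr linearZ /= block_rec_0pt // -[block ord0 (pt b) _]mul1mx.
  apply: opbound_le step0 _; rewrite -[X in opbound (X * _)]nV0; apply/opboundZ/opboundD; first exact: IHd.
  by rewrite mulrC; apply: opboundM; rewrite ?divr_ge0 ?(ltW r0) // mul1mx; apply: IHo.
rewrite (exprS x) -scalerAl linearZ /=.
case: (unliftP ord0 j) => [b|] -> ab; last first.
  rewrite block_rec_pt0 //; apply: opbound_le step0 _; rewrite -[X in opbound (X * _)]nV0; apply/opboundZ/opboundD; first exact: IHd.
  by apply: opboundM => //; apply: IHo.
rewrite (inj_eq lift_inj) in ab.
rewrite block_rec_pt_pt 1?eq_sym //; apply: opbound_le step _; rewrite -[X in opbound (X * _)]nV0; apply/opboundZ/opboundD.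
  apply: opboundD; first exact: IHo.
  by rewrite -[c ^+ p]mul1r; apply: opboundM => //; exact: (um_opbound um).
apply: opboundM; rewrite ?addr_ge0 //; first by apply: IHo; rewrite (inj_eq lift_inj).
by apply: opboundD => //; apply: opboundN; exact: (um_opbound um).
Qed.

End EntryBounds.

(** * Alternating products *)

Section AlternatingProducts.
Variables (C : numClosedFieldType) (n d : nat).
Variables (rho : mx_representation C [set: 'S_n]%G d) (K : C) (u : 'S_n -> 'M[C]_d).
Hypothesis um : unitary_model rho K u.
Local Notation opalg := (opalg C n).
Local Notation I := 'I_n.+1.
Local Notation pt := (lift (@ord0 n)).
Local Notation block i j T := (block u i j T).

Variable e : C.
Hypothesis e0 : 0 <= e.

(** Centered polynomials in the rescaled X are of this kind. *)
Record hollow (T : opalg) : Prop := Hollow {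
  hollow_cov : covariant u T;
  hollow_diag : forall i, block i i T = 0;
  hollow_opbound : forall i j, opbound e (block i j T)
}.

Definition diagonal (T : opalg) (g : I -> C) : Prop :=
  forall i j, block i j T = ((i == j)%:R * g i)%:M.

Definition centered_unit (g : I -> C) : Prop := (forall i, `|g i| <= 1) /\ \sum_i g i = 0.

(** The flag true stands for a polynomial in X, the flag false for one in P. *)
Definition factor_ok (f : bool * opalg) : Prop :=
  if f.1 then hollow f.2 else exists2 g, diagonal f.2 g & centered_unit g.

(** The product of blocks along the path from i through ks to j; the scalars
    attached to the intermediate indices are kept outside.  If ks is too short the
    value 0 keeps invariance and bounds valid. *)
Fixpoint path_prod (T : opalg) (L : seq ((I -> C) * opalg)) (i : I) (ks : seq I) (j : I) :
    'M[C]_d :=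
  match L, ks with
  | [::], _ => block i j T
  | (_, T') :: L', k :: ks' => block i k T *m path_prod T' L' k ks' j
  | _ :: _, [::] => 0
  end.

Fixpoint links_ok (L : seq ((I -> C) * opalg)) : Prop :=
  if L is (g, T) :: L' then [/\ centered_unit g, hollow T & links_ok L'] else True.

Lemma path_prod_cov T L a b i ks j : hollow T -> links_ok L ->
  let t := tperm (pt a) (pt b) in
  path_prod T L (t i) (map t ks) (t j) = u (tperm a b) *m path_prod T L i ks j *m u (tperm a b).
Proof.
elim: L T i ks => [|[g T'] L IH] T i ks hT; first by move=> _; apply: (hollow_cov hT).
case=> _ hT' okL t; case: ks => [|k ks] /=; first by rewrite mulmx0 mul0mx.
rewrite IH // (hollow_cov hT) !mulmxA; congr (_ *m _ *m _).
by rewrite -mulmxA (model_tpermK um) mulmx1.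
Qed.

Lemma path_prod_opbound T L i ks j : hollow T -> links_ok L ->
  opbound (e ^+ (size L).+1) (path_prod T L i ks j).
Proof.
elim: L T i ks => [|[g T'] L IH] T i ks hT; first by move=> _; apply: (hollow_opbound hT).
case=> _ hT' okL; case: ks => [|k ks] /=; first by apply: opbound0; rewrite exprn_ge0.
rewrite exprS; apply: opboundM; rewrite ?exprn_ge0 //; last exact: IH.
exact: (hollow_opbound hT).
Qed.

(** The matrix of T is a path sum, with scalars h and h' on the two end points. *)
Definition path_form (T : opalg) (h h' : I -> C) T0 L : Prop :=
  forall i j, block i j T =
    (h i * h' j) *: tsum (map fst L) (fun ks => path_prod T0 L i ks j).

(** Putting a hollow factor in front of a diagonal one turns the scalar h of the
    first index into that of an intermediate index, which must be centered. *)
Definition head_ok (s : seq (bool * opalg)) (h : I -> C) : Prop :=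
  if s is (false, _) :: _ then \sum_i h i = 0 else forall i, h i = 1.

Fixpoint all_ok (s : seq (bool * opalg)) : Prop :=
  if s is f :: s' then factor_ok f /\ all_ok s' else True.

Lemma tsumZ (V : lmodType C) gs (c : C) (F : seq I -> V) :
  tsum gs (fun s => c *: F s) = c *: tsum gs F.
Proof. by have /= -> := tsum_linear ( *:%R c : {linear V -> V}) gs F. Qed.

(** A single diagonal factor has to be excluded, for it has no block off the
    diagonal to start from. *)
Lemma alternating_path_form s :
  all_ok s -> sorted (fun f g => f.1 != g.1) s -> s != [::] -> (forall T, s != [:: (false, T)]) ->
  exists h h' T0 L, [/\ path_form (\prod_(f <- s) f.2) h h' T0 L,
    (forall i, `|h i| <= 1) /\ (forall i, `|h' i| <= 1), head_ok s h,
    hollow T0 /\ links_ok L & (size L < size s)%N].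
Proof.
elim: s => [|[c T] s IH] //= [okT oks] alt _ nsingle.
have [s0|s0] := eqVneq s [::].
  rewrite {}s0 in nsingle *; case: c okT nsingle {alt} => [hT _|okT /(_ T)]; last by rewrite eqxx.
  exists (fun=> 1), (fun=> 1), T, [::]; rewrite big_seq1; split=> //.
    by move=> i j; rewrite mulr1 scale1r.
  by split=> i; rewrite normr1.
have alts : sorted (fun f g : bool * opalg => f.1 != g.1) s by apply: path_sorted alt.
have headc : if c then exists T' s', s = (false, T') :: s' else exists T' s', s = (true, T') :: s'.
  case: (s) s0 alt => [//|[c' T'] s'] _ /= /andP[+ _].
  by case: c c' {okT nsingle} => -[] // _; exists T', s'.
rewrite big_cons /=; case: c okT headc alt {nsingle} => [hT|[g gT gok]] [T' [s' sE]] alt.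
  have [s'0|s'0] := eqVneq s' [::].
    move: oks; rewrite sE s'0 big_seq1 /= => -[[g gT' [g1 gc]] _].
    exists (fun=> 1), g, T, [::]; split=> //=.
      move=> i j; rewrite (blockM um) (bigD1 j) //= big1 => [|k kj]; last first.
        by rewrite gT' (negPf kj) mul0r raddf0 mulmx0.
      by rewrite gT' eqxx addr0 mul_mx_scalar !mul1r.
    by split=> // i; rewrite normr1.
  have nsing T1 : s != [:: (false, T1)].
    by rewrite sE; apply: contra s'0; rewrite eqseq_cons => /andP[].
  have [h [h' [T0 [L [form [h1 h'1] hh [hT0 okL] szL]]]]] := IH oks alts s0 nsing.
  rewrite sE /= in hh; exists (fun=> 1), h', T, ((h, T0) :: L); split=> //.
    move=> i j; rewrite (blockM um) mul1r /= scaler_sumr; apply: eq_bigr => k _.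
    rewrite form -scalemxAr mulrC -scalerA; congr (_ *: (_ *: _)).
    exact: (tsum_linear (mulmx (block i k T))).
  by split=> // i; rewrite normr1.
have nsing T1 : s != [:: (false, T1)] by rewrite sE eqseq_cons.
have [h [h' [T0 [L [form [h1 h'1] hh [hT0 okL] szL]]]]] := IH oks alts s0 nsing.
rewrite sE /= in hh; rewrite /= in gT; have [g1 gc] := gok.
exists g, h', T0, L; split=> //; last exact: ltnW.
move=> i j; rewrite (blockM um) (bigD1 i) //= [X in _ + X]big1 => [|k ki]; last first.
  by rewrite gT eq_sym (negPf ki) mul0r raddf0 mul0mx.
by rewrite gT eqxx mul1r addr0 mul_scalar_mx form hh mul1r scalerA.
Qed.

Lemma centered_diagonal_phi T g : diagonal T g -> \sum_i g i = 0 -> phi rho T = 0.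
Proof.
move=> gT gc; rewrite (phi_block um) -mulr_suml.
under eq_bigr do rewrite gT eqxx mul1r mxtrace_scalar.
by rewrite sumrMnl gc mul0rn mul0r mulr0.
Qed.

Variable R : C.
Hypotheses (R1 : 1 <= R) (RI : R ^+ 2 = n.+1%:R).

(** With l + 1 hollow factors, phi is (n+1)^-1 times a sum over one index with the
    bounded scalar h h' and l indices with centered scalars, so by [tsum_bound] the
    sum is at most of order (n+1) R^l e^(l+1).  A single diagonal factor is covered
    by phi = 0. *)
Lemma alternating_phi s : all_ok s -> sorted (fun f g => f.1 != g.1) s -> s != [::] ->
  exists2 l, (l < size s)%N &
  `|phi rho (\prod_(f <- s) f.2)| <= ((2 * l.+2) ^ l.+1)%:R * (e ^+ l.+1 * R ^+ l).
Proof.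
move=> oks alt s0.
have R0 : 0 <= R by apply: le_trans R1.
have [|[T sT]] : (forall T, s != [:: (false, T)]) \/ exists T, s = [:: (false, T)].
  case: (s) => [|[[] T] [|f s']]; try by left=> T'; rewrite ?eqseq_cons ?andbF.
  by right; exists T.
  move=> single.
  have [h [h' [T0 [L [form [h1 h'1] _ [hT0 okL] szL]]]]] := alternating_path_form oks alt s0 single.
  exists (size L) => //.
  pose F (ks : seq I) : C^o :=
    if ks is i :: ks' then \tr (path_prod T0 L i ks' i) / d%:R else 0.
  pose gs := (false, fun i => h i * h' i) :: [seq (true, gT.1) | gT <- L].
  have -> : phi rho (\prod_(f <- s) f.2) = n.+1%:R^-1 * tsum (map snd gs) F.
    rewrite (phi_block um) /=; congr (_ * _); apply: eq_bigr => i _.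
    rewrite form linearZ /= -[_ * _ / _]mulrA; congr (_ * _).
    rewrite -map_comp (eq_map (g := fst)) //.
    rewrite [\tr _](tsum_linear (@mxtrace C d : {linear _ -> C^o})) mulrC.
    apply: etrans (esym (@tsumZ C^o _ d%:R^-1 _)) _.
    by apply: eq_tsum => ks _; rewrite /F /= mulrC.
  have e1 : 0 <= e ^+ (size L).+1 by rewrite exprn_ge0.
  have bound := @tsum_bound C I R R1 _ gs [:: ord0] F (e ^+ (size L).+1).
  rewrite normrM normfV normr_nat ler_pdivrMl ?ltr0n //.
  apply: le_trans (bound _ _ _ _ _) _ => //.
  - by rewrite card_ord.
  - split; first by split=> // i; rewrite normrM mulr_ile1.
    elim: (L) okL => //= -[g T] L' IH [[g1 gc] _ okL']; split; last exact: IH.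
    by split.
  - move=> x y; rewrite !inE => x0 y0 [|i ks] //=.
    case: (unliftP ord0 x) x0 => [a|] -> //.
    case: (unliftP ord0 y) y0 => [b|] -> //.
    move=> _ _; rewrite path_prod_cov // mxtrace_mulC mulmxA.
    by rewrite (model_tpermK um) mul1mx.
  - move=> [|i ks]; first by rewrite normr0.
    rewrite normrM normfV normr_nat ler_pdivrMr ?ltr0n ?(um_dim um) // mulrC.
    exact/opbound_tr/path_prod_opbound.
  rewrite /weight big_cons /= RI big_map.
  rewrite (eq_bigr (fun=> R)) // big_const_seq count_predT iter_mulr mulr1 size_map.
  by rewrite addn1 2!(mulrCA _ n.+1%:R) lexx.
exists 0%N; first by rewrite sT.
rewrite sT big_seq1 /=; move: oks; rewrite sT => -[[/= g gT [_ gc]] _].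
by rewrite (centered_diagonal_phi gT gc) normr0 !mulr_ge0 // exprn_ge0.
Qed.

End AlternatingProducts.

(** * Polynomials in X and in P *)

Lemma horner_alg_sum (F : fieldType) (A : algType F) (a : A) (p : {poly F}) :
  horner_alg a p = \sum_(i < size p) p`_i *: a ^+ i.
Proof.
rewrite [in LHS](_ : p = \sum_(i < size p) p`_i *: 'X^i); last by rewrite -poly_def coefK.
by rewrite linear_sum; apply: eq_bigr => i _; rewrite linearZ /= rmorphXn /= horner_algX mulr_algl.
Qed.

Definition poly_le (C : numDomainType) (D : nat) (M : C) (p : {poly C}) : Prop :=
  (size p <= D)%N /\ forall i, `|p`_i| <= M.

Lemma poly_le_sum (C : numDomainType) D (M c : C) p : 0 <= M -> 1 <= c -> poly_le D M p ->
  \sum_(i < size p) `|p`_i| * c ^+ i <= D%:R * (M * c ^+ D).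
Proof.
move=> M0 c1 [szp pM]; have c0 : 0 <= c by apply: le_trans c1.
apply: (@le_trans _ _ (\sum_(i < size p) M * c ^+ D)).
  apply: ler_sum => i _; apply: ler_pM; rewrite ?exprn_ge0 //.
  by rewrite ler_weXn2l // ltnW // (leq_trans (ltn_ord i)).
rewrite sumr_const card_ord -[leLHS]mulr_natl ler_wpM2r ?mulr_ge0 ?exprn_ge0 //.
by rewrite ler_nat.
Qed.

Section PolynomialFactors.
Variables (C : numClosedFieldType) (n d : nat).
Variables (rho : mx_representation C [set: 'S_n]%G d) (K : C) (u : 'S_n -> 'M[C]_d).
Hypothesis um : unitary_model rho K u.
Local Notation I := 'I_n.+1.
Local Notation block i j T := (block u i j T).
Variables (r c : C) (k : nat).
Hypotheses (r1 : 1 <= r) (rn : r ^+ 2 = n%:R) (c1 : 1 <= c) (K0 : 0 <= K).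
Hypothesis rKc : r + K + 2 <= c * r.
Local Notation x := (r^-1 *: Xop C n).
Local Notation P := (Pop C n k).

Let r0 : 0 < r. Proof. exact: lt_le_trans r1. Qed.
Let c0 : 0 <= c. Proof. exact: le_trans c1. Qed.
Let xb := x_bounds um r1 rn c1 K0 rKc.

Lemma block_horner_x i j p :
  block i j (horner_alg x p) = \sum_(l < size p) p`_l *: block i j (x ^+ l).
Proof.
by rewrite horner_alg_sum linear_sum; apply: eq_bigr => l _; rewrite linearZ.
Qed.

Lemma covariant_horner_x p : covariant u (horner_alg x p).
Proof.
rewrite horner_alg_sum; elim/big_rec: _ => [|l T _ cT].
  by move=> a b i j; rewrite !linear0 ?mulmx0 ?mul0mx.
by apply: covariantD => //; apply: covariantZ; apply: (covariant_x um).
Qed.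

(** All diagonal blocks are equal to the same scalar, which is then the mean. *)
Lemma block_horner_x_diag i p : block i i (horner_alg x p) = (phi rho (horner_alg x p))%:M.
Proof.
have diag j : block j j (horner_alg x p) = block ord0 ord0 (horner_alg x p).
  by rewrite !block_horner_x; apply: eq_bigr => l _; rewrite (x_diag u).
have [m mE] := covariant_scalar um (covariant_horner_x p).
rewrite diag mE (phi_block um); congr _%:M.
under eq_bigr do rewrite diag mE mxtrace_scalar -(mulr_natr m) mulfK ?pnatr_eq0 -?lt0n ?(um_dim um) //.
by rewrite sumr_const card_ord -(mulr_natl m) mulKf ?pnatr_eq0.
Qed.

Section Bounded.
Variables (D : nat) (M : C).
Hypothesis M0 : 0 <= M.
(** A common bound for polynomials of size at most D with coefficients at most M,
    in X and in P; the summand 1 keeps it at least 1. *)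
Definition factor_bound : C := 1 + D%:R * (M * c ^+ D).

Lemma factor_bound_ge1 : 1 <= factor_bound.
Proof. by rewrite lerDl !mulr_ge0 ?exprn_ge0. Qed.

Let E0 : 0 <= factor_bound. Proof. exact: le_trans factor_bound_ge1. Qed.

Lemma opbound_horner_x p i : poly_le D M p -> opbound factor_bound (block i i (horner_alg x p)).
Proof.
move=> pDM; rewrite block_horner_x.
apply: (@opbound_le _ _ (\sum_(l < size p) `|p`_l| * c ^+ l)).
  by rewrite (le_trans (poly_le_sum M0 c1 pDM)) // lerDr.
by apply: opbound_sum => l _; apply: opboundZ; apply: (xb l).1.
Qed.

Lemma phi_horner_x p : poly_le D M p -> `|phi rho (horner_alg x p)| <= factor_bound.
Proof.
move=> pDM; have := opbound_tr (opbound_horner_x ord0 pDM).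
rewrite block_horner_x_diag mxtrace_scalar normrMn -[leLHS]mulr_natl ler_pM2l //.
by rewrite ltr0n (um_dim um).
Qed.

Lemma hollow_horner_x p : poly_le D M p -> phi rho (horner_alg x p) = 0 ->
  hollow u (factor_bound / r) (horner_alg x p).
Proof.
move=> pDM p0; have diag0 i : block i i (horner_alg x p) = 0.
  by rewrite block_horner_x_diag p0 raddf0.
split=> //; first exact: covariant_horner_x.
move=> i j; have [->|ij] := eqVneq i j.
  by rewrite diag0; apply: opbound0; rewrite divr_ge0 // ltW.
rewrite block_horner_x.
apply: (@opbound_le _ _ (\sum_(l < size p) `|p`_l| * (c ^+ l / r))).
  under eq_bigr do rewrite mulrA.
  rewrite -mulr_suml ler_wpM2r ?invr_ge0 ?(ltW r0) //.
  by rewrite (le_trans (poly_le_sum M0 c1 pDM)) // lerDr.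
by apply: opbound_sum => l _; apply: opboundZ; apply: (xb l).2.
Qed.

Definition P_value (i : I) : C := (i <= k)%N%:R.

Lemma diagonal_horner_P p : diagonal u (horner_alg P p) (fun i => p.[P_value i]).
Proof.
have powP l i j : block i j (P ^+ l) = ((i == j)%:R * P_value i ^+ l)%:M.
  elim: l i j => [|l IH] i j; first by rewrite (block1 um) mulr1.
  rewrite exprS (blockM um) (bigD1 i) //= [X in _ + X]big1 ?addr0 => [|m mi]; last first.
    by rewrite (blockP um) eq_sym (negPf mi) raddf0 mul0mx.
  rewrite (blockP um) IH eqxx /= -scalar_mxM; congr _%:M.
  by rewrite mulrCA -exprS.
move=> i j; rewrite horner_alg_sum linear_sum horner_coef mulr_sumr raddf_sum /=.
apply: eq_bigr => l _; rewrite linearZ /= powP -scalemx1 scalerA scalemx1.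
by rewrite mulrCA.
Qed.

Lemma horner_P_le p i : poly_le D M p -> `|p.[P_value i]| <= factor_bound.
Proof.
move=> pDM; rewrite horner_coef (le_trans (ler_norm_sum _ _ _)) //.
rewrite (@le_trans _ _ (\sum_(l < size p) `|p`_l| * c ^+ l)) //; last first.
  by rewrite (le_trans (poly_le_sum M0 c1 pDM)) // lerDr.
apply: ler_sum => l _; rewrite normrM ler_wpM2l // normrX.
rewrite (@le_trans _ _ 1) ?exprn_ege1 // exprn_ile1 //.
by rewrite /P_value; case: (i <= k)%N; rewrite ?normr0 ?normr1.
Qed.

Lemma phi_horner_P p : phi rho (horner_alg P p) = n.+1%:R^-1 * \sum_i p.[P_value i].
Proof.
rewrite (phi_block um); congr (_ * _); apply: eq_bigr => i _.
rewrite diagonal_horner_P eqxx mul1r mxtrace_scalar -(mulr_natr p.[_]) mulfK //.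
by rewrite pnatr_eq0 -lt0n (um_dim um).
Qed.

Lemma phi_horner_P_le p : poly_le D M p -> `|phi rho (horner_alg P p)| <= factor_bound.
Proof.
move=> pDM; rewrite phi_horner_P normrM normfV normr_nat ler_pdivrMl ?ltr0n //.
apply: (le_trans (ler_norm_sum _ _ _)).
apply: (@le_trans _ _ (\sum_(i : I) factor_bound)).
  by apply: ler_sum => i _; apply: horner_P_le.
by rewrite sumr_const card_ord mulr_natl.
Qed.

Definition poly_factor (f : bool * {poly C}) : opalg C n :=
  horner_alg (if f.1 then x else P) f.2.

Lemma phi_factor_le f : poly_le D M f.2 -> `|phi rho (poly_factor f)| <= factor_bound.
Proof.
by case: f => [[] p]; [exact: phi_horner_x | exact: phi_horner_P_le].
Qed.

(** Factors in P are rescaled to have entries at most 1, as [tsum_bound] needs. *)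
Let scaled f : bool * opalg C n :=
  (f.1, if f.1 then poly_factor f else factor_bound^-1 *: poly_factor f).

Let scaled_ok f : poly_le D M f.2 -> phi rho (poly_factor f) = 0 ->
  factor_ok u (factor_bound / r) (scaled f).
Proof.
have Epos : 0 < factor_bound by apply: lt_le_trans factor_bound_ge1.
case: f => [[] p] pDM p0 /=; first exact: hollow_horner_x.
exists (fun i => factor_bound^-1 * p.[P_value i]).
  move=> i j; rewrite /scaled /= linearZ /= diagonal_horner_P.
  by rewrite -scalemx1 scalerA scalemx1 mulrCA.
split=> [i|].
  rewrite normrM normfV (ger0_norm E0) ler_pdivrMl // mulr1.
  exact: horner_P_le.
move: p0; rewrite /poly_factor /= phi_horner_P => /eqP.
rewrite mulf_eq0 invr_eq0 pnatr_eq0 /= => /eqP p0.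
by rewrite -mulr_sumr p0 mulr0.
Qed.

(** In [alternating_phi] take e = factor_bound / r.  As n + 1 <= (2 r)^2, the powers
    of r cancel up to one factor r^-1, whatever the number l + 1 of hollow factors
    is. *)
Lemma alternating_poly_phi (s : seq (bool * {poly C})) :
  (0 < n)%N ->
  (forall f, f \in s -> poly_le D M f.2 /\ phi rho (poly_factor f) = 0) ->
  sorted (fun f g => f.1 != g.1) s -> s != [::] ->
  `|phi rho (\prod_(f <- s) poly_factor f)| <=
    factor_bound ^+ size s * (((2 * (size s).+1) ^ size s)%:R * (2 ^+ size s * factor_bound ^+ size s)) / r.
Proof.
move=> n0 sP alt s0; set S := size s; set E := factor_bound.
have E1 : 1 <= E := factor_bound_ge1.
have Epos : 0 < E by apply: lt_le_trans E1.
pose w := \prod_(f <- s) (if f.1 then 1 else E).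
have -> : \prod_(f <- s) poly_factor f = w *: \prod_(f <- map scaled s) f.2.
  have unscale f : poly_factor f = (if f.1 then 1 else E) *: (scaled f).2.
    by case: f => [[] p] /=; rewrite ?scale1r // scalerA divff ?gt_eqF ?scale1r.
  rewrite /w big_map; elim: (s) => [|f s' IH]; first by rewrite !big_nil scale1r.
  by rewrite !big_cons IH unscale -scalerAl -scalerAr scalerA.
have wE : `|w| <= E ^+ S.
  rewrite /w /S normr_prod; elim: (s) => [|f s' IH]; first by rewrite big_nil.
  rewrite big_cons /= exprS ler_pM ?prodr_ge0 //.
  by case: f.1 => /=; rewrite ?normr1 ?(ger0_norm E0).
pose R : C := sqrtC n.+1%:R.
have RI : R ^+ 2 = n.+1%:R by rewrite sqrtCK.
have R1 : 1 <= R by rewrite -[1]sqrtC1 ler_sqrtC ?nnegrE // ler1n.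
have R0 : 0 <= R by apply: le_trans R1.
have Rr : R <= 2 * r.
  rewrite -(@ler_pXn2r _ 2) ?nnegrE ?mulr_ge0 ?(ltW r0) // exprMn RI rn -natrX -natrM.
  by rewrite ler_nat; case: (n) n0 => // m _; rewrite (_ : (2 ^ 2)%N = 4%N) // mulnS -[m.+2]add2n leq_add // leq_pmull.
have e0 : 0 <= E / r by rewrite divr_ge0 // ltW.
have [||| l lS bound] := @alternating_phi _ _ _ _ _ _ um _ e0 R R1 RI (map scaled s).
- elim: (s) sP => //= f s' IH sP; split.
    by have [] := sP f (mem_head _ _); exact: scaled_ok.
  by apply: IH => g gs; apply: sP; rewrite inE gs orbT.
- by rewrite sorted_map; apply: sub_sorted alt => f g.
- by case: (s) s0.
rewrite size_map -/S in lS.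
rewrite linearZ /= normrM -!mulrA ler_pM //; apply: (le_trans bound).
rewrite ler_pM ?mulr_ge0 ?exprn_ge0 ?invr_ge0 ?(ltW r0) //.
  rewrite ler_nat (@leq_trans ((2 * S.+1) ^ l.+1)) //.
    by rewrite leq_exp2r // leq_mul2l.
  by rewrite leq_pexp2l.
rewrite mulrC; apply: (@le_trans _ _ ((2 * r) ^+ l * (E / r) ^+ l.+1)).
  rewrite ler_wpM2r ?exprn_ge0 //; apply: lerXn2r; rewrite ?nnegrE ?mulr_ge0 ?(ltW r0) //.
have -> : (2 * r) ^+ l * (E / r) ^+ l.+1 = 2 ^+ l * E ^+ l.+1 / r.
  rewrite exprMn (exprS (E / r)) expr_div_n (exprS E).
  by field; rewrite ?expf_eq0 ?gt_eqF ?andbF.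
rewrite !mulrA ler_wpM2r ?invr_ge0 ?(ltW r0) // ler_pM ?exprn_ge0 //.
  by rewrite ler_weXn2l ?ler1n // ltnW.
by rewrite ler_weXn2l.
Qed.

End Bounded.
End PolynomialFactors.

(** * From alternating products to all words *)

Section Vanishing.
Variable C : numFieldType.
Implicit Types u v : nat -> C.

Definition vanish u : Prop :=
  forall e : C, 0 < e -> exists N, forall n, (N <= n)%N -> `|u n| < e.

Definition bounded_seq u : Prop :=
  exists2 M : C, 0 <= M & forall n, (0 < n)%N -> `|u n| <= M.

Lemma vanish_ext u v : (forall n, (0 < n)%N -> u n = v n) -> vanish u -> vanish v.
Proof.
move=> uv u0 e e0; have [N uN] := u0 e e0; exists N.+1 => n Nn.
by rewrite -uv ?uN // ?(ltnW Nn) // (leq_ltn_trans _ Nn).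
Qed.

Lemma vanish_le u v : (forall n, (0 < n)%N -> `|u n| <= v n) -> vanish v -> vanish u.
Proof.
move=> uv v0 e e0; have [N vN] := v0 e e0; exists N.+1 => n Nn.
have n0 : (0 < n)%N by apply: leq_ltn_trans Nn.
have vn0 : 0 <= v n by apply: le_trans (uv n n0).
by apply: le_lt_trans (vN n (ltnW Nn)); rewrite (ger0_norm vn0) uv.
Qed.

Lemma vanish0 : vanish (fun=> 0).
Proof. by move=> e e0; exists 0%N => n _; rewrite normr0. Qed.

Lemma vanishD u v : vanish u -> vanish v -> vanish (fun n => u n + v n).
Proof.
move=> u0 v0 e e0; have e20 : 0 < e / 2 by rewrite divr_gt0.
have [N uN] := u0 _ e20; have [N' vN] := v0 _ e20; exists (maxn N N') => n.
rewrite geq_max => /andP[/uN un /vN vn].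
by rewrite (le_lt_trans (ler_normD _ _)) // [ltRHS](splitr e) ltrD.
Qed.

Lemma vanishM u v : bounded_seq u -> vanish v -> vanish (fun n => u n * v n).
Proof.
case=> M M0 uM v0 e e0; have M1 : 0 < M + 1 by rewrite ltr_wpDl.
have [N vN] := v0 (e / (M + 1)) (divr_gt0 e0 M1); exists N.+1 => n Nn.
have n0 : (0 < n)%N by apply: leq_ltn_trans Nn.
rewrite normrM (@le_lt_trans _ _ ((M + 1) * `|v n|)) //.
  by rewrite ler_wpM2r // (le_trans (uM _ n0)) // lerDl.
by rewrite mulrC -ltr_pdivlMr // vN // ltnW.
Qed.

End Vanishing.

Section PolynomialFamilies.
Variable C : numFieldType.
Implicit Types p q : nat -> {poly C}.

(** Means depend on n, so centering leads from fixed polynomials to families of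
    them, uniformly bounded in degree and coefficients. *)
Definition poly_bounded p : Prop :=
  exists D, exists2 M : C, 0 <= M & forall n, (0 < n)%N -> poly_le D M (p n).

Lemma poly_bounded_cst (p : {poly C}) : poly_bounded (fun=> p).
Proof.
exists (size p); exists (\sum_(i < size p) `|p`_i|) => [|n _]; first exact: sumr_ge0.
split=> // i; case: (ltnP i (size p)) => [lt_i|le_i].
  by rewrite (bigD1 (Ordinal lt_i)) //= lerDl sumr_ge0.
by rewrite nth_default // normr0 sumr_ge0.
Qed.

Lemma poly_bounded_shift p m : poly_bounded p -> bounded_seq m ->
  poly_bounded (fun n => p n - (m n)%:P).
Proof.
move=> [D [M M0 pDM]] [M' M'0 mM]; exists (maxn D 1).
exists (M + M') => [|n n0]; first exact: addr_ge0.
have [szp pM] := pDM n n0; split=> [|i].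
  rewrite (leq_trans (size_polyD _ _)) // size_polyN geq_max !leq_max szp /=.
  by rewrite size_polyC leq_b1 orbT.
rewrite coefB coefC (le_trans (ler_normB _ _)) // lerD //.
by case: eqP => _; rewrite ?mM // normr0.
Qed.

Lemma poly_bounded_mul p q : poly_bounded p -> poly_bounded q ->
  poly_bounded (fun n => p n * q n).
Proof.
move=> [D [M M0 pDM]] [D' [M' M'0 qDM]]; exists (D + D')%N.
exists ((D + D')%:R * (M * M')) => [|n n0]; first by rewrite !mulr_ge0.
have [szp pM] := pDM n n0; have [szq qM] := qDM n n0.
have szpq : (size (p n * q n)%R <= D + D')%N.
  rewrite (leq_trans (size_polyMleq _ _)) // (leq_trans (leq_pred _)) //.
  exact: leq_add.
split=> // i; case: (ltnP i (D + D')) => [lt_i|le_i]; last first.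
  by rewrite nth_default ?normr0 ?mulr_ge0 // (leq_trans szpq).
rewrite coefM (le_trans (ler_norm_sum _ _ _)) //.
apply: (@le_trans _ _ (\sum_(j < i.+1) M * M')).
  by apply: ler_sum => j _; rewrite normrM ler_pM.
by rewrite sumr_const card_ord -[leLHS]mulr_natl ler_wpM2r ?mulr_ge0 // ler_nat.
Qed.

End PolynomialFamilies.

Section AsymptoticFreeness.
Variable C : numFieldType.
Variables (A B : nat -> algType C).
Variables (phi : forall n, {scalar A n}) (psi : forall n, {scalar B n}).
Variables (x y : forall n, A n) (a b : forall n, B n).

Definition factor : Type := bool * (nat -> {poly C}).
Implicit Types (f g : factor) (s : seq factor).

Definition evA n f : A n := horner_alg (if f.1 then x n else y n) (f.2 n).
Definition evB n f : B n := horner_alg (if f.1 then a n else b n) (f.2 n).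

Fixpoint all_bounded s : Prop :=
  if s is f :: s' then poly_bounded f.2 /\ all_bounded s' else True.
Fixpoint all_centered s : Prop :=
  if s is f :: s' then (forall n, (0 < n)%N -> phi n (evA n f) = 0) /\ all_centered s' else True.

Lemma all_bounded_uniform s : all_bounded s -> exists D, exists2 M : C, 0 <= M &
  forall n, (0 < n)%N ->
    forall g : bool * {poly C}, g \in [seq (f.1, f.2 n) | f <- s] -> poly_le D M g.2.
Proof.
elim: s => [_|f s IH /= [[D [M M0 fDM]] /IH[D' [M' M'0 sDM]]]].
  by exists 0%N; exists 0.
exists (maxn D D'); exists (M + M') => [|n n0 g]; first exact: addr_ge0.
rewrite inE => /orP[/eqP-> | /(sDM n n0)[szg gM]] /=.
  have [szf fM] := fDM n n0; split=> [|i]; first by rewrite leq_max szf.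
  by rewrite (le_trans (fM i)) // lerDl.
split=> [|i]; first by rewrite leq_max szg orbT.
by rewrite (le_trans (gM i)) // lerDr.
Qed.

Hypothesis phi1 : forall n, (0 < n)%N -> phi n 1 = 1.
Hypothesis psi1 : forall n, (0 < n)%N -> psi n 1 = 1.
Hypothesis a_moments : forall n, (0 < n)%N -> same_moments (psi n) (a n) (phi n) (x n).
Hypothesis b_moments : forall n, (0 < n)%N -> same_moments (psi n) (b n) (phi n) (y n).
Hypothesis ab_free : forall n, (0 < n)%N -> free_pair (psi n) (a n) (b n).
Hypothesis phi_bounded : forall f, poly_bounded f.2 -> bounded_seq (fun n => phi n (evA n f)).
Hypothesis phi_vanish : forall s, all_bounded s -> all_centered s ->
  sorted (fun f g => f.1 != g.1) s -> s <> [::] ->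
  vanish (fun n => phi n (\prod_(f <- s) evA n f)).

Lemma evAB n f : (0 < n)%N -> psi n (evB n f) = phi n (evA n f).
Proof.
move=> n0; rewrite /evA /evB; case: f => c p /=; rewrite !horner_alg_sum !linear_sum.
by apply: eq_bigr => i _; rewrite !linearZ /=; case: c; rewrite ?a_moments ?b_moments.
Qed.

Definition gap s n : C :=
  phi n (\prod_(f <- s) evA n f) - psi n (\prod_(f <- s) evB n f).

Lemma gap_merge s1 s2 c (p q : nat -> {poly C}) n :
  gap (s1 ++ (c, p) :: (c, q) :: s2) n = gap (s1 ++ (c, fun n => p n * q n) :: s2) n.
Proof. by rewrite /gap !big_cat !big_cons /= /evA /evB /= !rmorphM !mulrA. Qed.

Lemma gap_shift s1 s2 c (p : nat -> {poly C}) (m : nat -> C) n :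
  gap (s1 ++ (c, p) :: s2) n =
  gap (s1 ++ (c, fun n => p n - (m n)%:P) :: s2) n + m n * gap (s1 ++ s2) n.
Proof.
have split_ev (E : algType C) (z : E) (P Q : E) :
    P * (horner_alg z (p n) * Q) =
    P * (horner_alg z (p n - (m n)%:P) * Q) + m n *: (P * Q).
  rewrite rmorphB /= horner_algC mulrBl mulr_algl mulrBr -scalerAr.
  by rewrite subrK.
rewrite /gap !big_cat !big_cons /= /evA /evB /= !split_ev.
rewrite [phi n (_ + _)]linearD [psi n (_ + _)]linearD [phi n (_ *: _)]linearZ.
by rewrite [psi n (_ *: _)]linearZ /= mulrBr opprD addrACA.
Qed.

Lemma all_bounded_cat s1 s2 : all_bounded (s1 ++ s2) <-> all_bounded s1 /\ all_bounded s2.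
Proof.
elim: s1 => [|f s1 IH] /=; first by split=> [|[]].
by rewrite IH; split=> [[? [? ?]]|[[? ?] ?]].
Qed.

Lemma all_centered_rcons s f : all_centered s ->
  (forall n, (0 < n)%N -> phi n (evA n f) = 0) -> all_centered (rcons s f).
Proof. by elim: s => [|g s IH] //= [gc sc] fc; split=> //; apply: IH. Qed.

Lemma psi_alternating s n : (0 < n)%N -> all_centered s ->
  sorted (fun f g => f.1 != g.1) s -> s <> [::] -> psi n (\prod_(f <- s) evB n f) = 0.
Proof.
move=> n0 sc alt s0; have := ab_free n0 (s := [seq (f.1, evB n f) | f <- s]).
rewrite big_map; apply.
- by case: (s) s0.
- by rewrite sorted_map.
elim: (s) sc => [|f s' IH] //= [fc sc] v; rewrite inE => /orP[/eqP ->|vs].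
  by split; [exists (f.2 n) | rewrite /= evAB // fc].
exact: IH.
Qed.

(** Induction on the length of s; within a given length, the prefix that is already
    centered and alternating grows.  Its next factor p is replaced by p - m with m
    the mean of p, at the cost of m times the gap of a shorter list.  If p - m is in
    the same variable as the last factor of the prefix, these two merge and the list
    gets shorter; otherwise the prefix is extended.  At the end the gap is that of a
    centered alternating product, where psi is zero and phi vanishes in the
    limit. *)
Lemma asymptotic_freeness s : all_bounded s -> vanish (gap s).
Proof.
have [L] := ubnP (size s); elim: L s => // L IHL s szs bs.
suff main suf pre : (size pre + size suf <= L)%N -> all_bounded pre -> all_bounded suf ->
    all_centered pre -> sorted (fun f g => f.1 != g.1) pre -> vanish (gap (pre ++ suf)).
  by apply: (main s [::]).
elim: suf pre => [|[c p] suf IH] pre szL bpre bsuf cpre alt.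
  rewrite cats0; case: (pre) cpre alt bpre => [|f pre'] cpre alt bpre.
    apply: vanish_ext (@vanish0 C) => n n0.
    by rewrite /gap !big_nil phi1 // psi1 // subrr.
  apply: vanish_ext (phi_vanish bpre cpre alt _) => // n n0.
  by rewrite /gap [psi n _]psi_alternating // subr0.
have [bp bsuf'] := bsuf; have bm := phi_bounded (f := (c, p)) bp.
set m := (fun n => phi n (evA n (c, p))) in bm.
apply: (@vanish_ext _ (fun n => gap (pre ++ (c, fun n => p n - (m n)%:P) :: suf) n
    + m n * gap (pre ++ suf) n)) => [n _|]; first by rewrite [RHS](gap_shift _ _ _ _ m).
have bp' := poly_bounded_shift bp bm.
have szL' : (size pre + size suf < L)%N by rewrite -addnS.
apply: vanishD; last first.
  apply: vanishM => //; apply: IHL; first by rewrite size_cat.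
  exact/all_bounded_cat.
have cp' n : (0 < n)%N -> phi n (evA n (c, fun n => p n - (m n)%:P)) = 0.
  move=> n0; rewrite /evA /= rmorphB /= horner_algC linearB /= -/(evA n (c, p)) -/(m n).
  by rewrite linearZ /= phi1 // mulr1 subrr.
case: (lastP pre) alt szL bpre cpre szL' => [|pre' [c' q]] alt szL bpre cpre szL'.
  by apply: (IH [:: _]).
have [ec|ec] := eqVneq c' c.
  rewrite cat_rcons ec; apply: vanish_ext (fun n _ => esym (gap_merge _ _ _ _ _ n)) _.
  move: bpre; rewrite -cats1 all_bounded_cat => -[bpre' [bq _]].
  apply: IHL; first by move: szL'; rewrite size_cat size_rcons /= addnS.
  by apply/all_bounded_cat; split=> //=; split=> //; apply: poly_bounded_mul.
rewrite -cat_rcons; apply: IH => //.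
- by rewrite size_rcons addSnnS.
- by rewrite -cats1; apply/all_bounded_cat.
- exact: all_centered_rcons.
move: alt; case: (pre') => [|h pre''] /=; first by rewrite ec.
by rewrite !rcons_path last_rcons /= => ->.
Qed.

End AsymptoticFreeness.

(** * The theorem *)

Local Open Scope classical_set_scope.
Local Open Scope ring_scope.
Local Open Scope complex_scope.

Lemma vanish_cvg (R : realType) (f : nat -> R[i]) : vanish f ->
  (f : nat -> R[i]^o) @ \oo --> (0 : R[i]^o).
Proof.
move=> f0; apply/cvgr0Pnorm_lt => e e0.
have [N fN] := f0 e e0; exists N => // n Nn; exact: fN.
Qed.

Lemma vanish_const_div_sqrt (R : realType) (c : R[i]) :
  0 <= c -> vanish (fun n => c / (Num.sqrt n%:R : R)%:C).
Proof.
move=> c0 e e0; have q0 : 0 <= c / e by rewrite divr_ge0 // ltW.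
pose t : R := complex.Re (c / e).
have ct : c / e = t%:C by rewrite /t RRe_real // ger0_real.
have t0 : 0 <= t by rewrite -lecR -ct.
exists (Num.bound (t ^+ 2)).+1 => n Nn.
have tn : t < Num.sqrt n%:R.
  rewrite -(ger0_norm t0) -sqrtr_sqr ltr_sqrt; last by rewrite ltr0n (leq_ltn_trans _ Nn).
  rewrite (lt_le_trans (archi_boundP (exprn_ge0 _ t0))) // ler_nat; exact: ltnW.
have s0 : 0 < (Num.sqrt n%:R : R)%:C.
  by rewrite ltcR; apply: le_lt_trans tn.
rewrite ger0_norm; last exact: divr_ge0 c0 (ltW s0).
rewrite ltr_pdivrMr // mulrC -ltr_pdivrMr //.
by rewrite ct ltcR.
Qed.

Theorem mainTheorem1
  (R : realType) (A : R) (A_gt1 : 1 < A)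
  (la : nat -> seq nat)
  (la_young : forall n, (0 < n)%N -> young_diagram n (la n))
  (la_balanced : forall n, (0 < n)%N -> balanced A n (la n))
  (la_shape : has_limit_shape R la)
  (d : nat -> nat)
  (rho : forall n, mx_representation R[i] [set: 'S_n]%G (d n))
  (rho_la : forall n, (0 < n)%N -> irrep_of_shape (la n) (rho n))
  (k : nat -> nat) (k_le : forall n, (0 < n)%N -> (k n <= n)%N)
  (B : nat -> algType R[i]) (psi : forall n, {scalar B n})
  (psi1 : forall n, (0 < n)%N -> psi n 1 = 1)
  (a b : forall n, B n)
  (ab_free : forall n, (0 < n)%N -> free_pair (psi n) (a n) (b n))
  (a_moments : forall n, (0 < n)%N ->
     same_moments (psi n) (a n)
       (phi (rho n)) (((Num.sqrt n%:R)^-1 : R)%:C *: Xop R[i] n))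
  (b_moments : forall n, (0 < n)%N ->
     same_moments (psi n) (b n) (phi (rho n)) (Pop R[i] n (k n)))
  (w : seq bool) :
  (fun n => phi (rho n)
              (word_eval w (((Num.sqrt n%:R)^-1 : R)%:C *: Xop R[i] n)
                           (Pop R[i] n (k n)))
            - psi n (word_eval w (a n) (b n)) : R[i]^o) @ \oo --> (0 : R[i]^o).
Proof.
pose r n : R[i] := (Num.sqrt n%:R : R)%:C.
pose K n : R[i] := (A * Num.sqrt n%:R)%:C.
(* for n >= 1, 1 <= sqrt n and so sqrt n + A sqrt n + 2 <= (A + 3) sqrt n *)
pose c : R[i] := (A + 3)%:C.
have A0 : 0 <= A by apply: ltW; apply: lt_trans A_gt1.
have r1 n : (0 < n)%N -> 1 <= r n.
  by move=> n0; rewrite /r lecR -[leLHS]sqrtr1 ler_wsqrtr // ler1n.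
have rn n : r n ^+ 2 = n%:R.
  by rewrite /r -rmorphXn /= sqr_sqrtr ?ler0n // rmorph_nat.
have c1 : 1 <= c by rewrite lecR; lra.
have K0 n : 0 <= K n by rewrite lecR mulr_ge0 ?sqrtr_ge0.
have rKc n : (0 < n)%N -> r n + K n + 2 <= c * r n.
  move=> n0; have := r1 n n0; rewrite /r /K /c lecR => s1.
  rewrite -[2]/(2%:R) -(rmorph_nat (real_complex R)) -!rmorphD -rmorphM /= lecR.
  nra.
have rV n : ((Num.sqrt n%:R)^-1 : R)%:C = (r n)^-1 by rewrite /r fmorphV.
have model n : (0 < n)%N -> exists u, unitary_model (rho n) (K n) u.
  move=> n0; have [rows cols] := la_balanced n n0; have yd := la_young n n0.
  apply: (unitary_model_exists yd (rho_la n n0)).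
    move=> i; rewrite -(rmorph_nat (real_complex R)) lecR; exact: rows.
  (* no part is zero, so the first column meets all rows *)
  have <- : col_length (la n) 0 = size (la n).
    apply/eqP; rewrite /col_length -all_count; case/and3P: yd => _ la0 _.
    by apply/allP => l lla; rewrite -[ltn 0 l]/(0 < l)%N lt0n; apply: contraNneq la0 => <-.
  by rewrite -(rmorph_nat (real_complex R)) lecR.
pose s : seq (bool * (nat -> {poly R[i]})) := [seq (l, fun=> 'X) | l <- w].
have bs : all_bounded s.
  by rewrite /s; elim: (w) => //= l w' IH; split=> //; apply: poly_bounded_cst.
have wordE (E : algType R[i]) (z t : E) n :
    \prod_(f <- s) horner_alg (if f.1 then z else t) (f.2 n) = word_eval w z t.
  by rewrite /s /word_eval big_map; apply: eq_bigr => l _; rewrite horner_algX.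
apply: vanish_cvg.
apply: vanish_ext (asymptotic_freeness (phi := fun n => phi (rho n)) (psi := psi)
  (x := fun n => ((Num.sqrt n%:R)^-1 : R)%:C *: Xop R[i] n) (y := fun n => Pop R[i] n (k n))
  _ psi1 a_moments b_moments ab_free _ _ bs) => [n n0|n n0|[l p] [D [M M0 pDM]]|t].
- by rewrite /gap /evA /evB !wordE.
- have [u um] := model n n0; exact: phi1 (um_dim um).
- exists (factor_bound c D M) => [|n n0]; first exact: le_trans (factor_bound_ge1 c1 D M0).
  have [u um] := model n n0; rewrite /evA rV.
  exact: (phi_factor_le um (k n) (r1 n n0) (rn n) c1 (K0 n) (rKc n n0) M0 (f := (l, p n)) (pDM n n0)).
move=> bt ct alt t0.
have [D [M M0 tDM]] := all_bounded_uniform bt.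
set E := factor_bound c D M; set S := size t.
have E0 : 0 <= E by apply: le_trans (factor_bound_ge1 c1 D M0).
pose c' : R[i] := E ^+ S * (((2 * S.+1) ^ S)%:R * (2 ^+ S * E ^+ S)).
have c'0 : 0 <= c' by rewrite !mulr_ge0 ?exprn_ge0 ?ler0n.
apply: vanish_le (vanish_const_div_sqrt c'0) => n n0.
have [u um] := model n n0.
have := alternating_poly_phi um (k := k n) (r1 n n0) (rn n) c1 (K0 n) (rKc n n0) M0
  (s := [seq (f.1, f.2 n) | f <- t]) n0.
rewrite big_map size_map /evA rV; apply.
- move=> f ft; split; first exact: tDM ft.
  move: ft; elim: (t) ct => //= g t' IH [gc tc]; rewrite inE => /orP[/eqP->|]; last exact: IH.
  by have := gc n n0; rewrite /evA rV.
- by rewrite sorted_map.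
by case: (t) t0.
Qed.
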